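(* Assume that the optimal solution set $\Omega_P$ of the primal problem $$\min_{X\in\mathbb{X}}\ \Phi(X):=h(\mathcal{F}X)+\langle C,X\rangle+\theta(X)\quad\text{s.t.}\quad\mathcal{A}X\in b+\mathcal{Q}$$ is nonempty. Let $\Psi^*$ denote the optimal value of the dual problem $$\min_{Z=(y,w,S)\in\mathbb{R}^e\times\mathbb{R}^d\times\mathbb{X}}\ \Psi(Z):=\delta_{\mathcal{Q}^*}(y)-\langle b,y\rangle+h^*(-w)+\theta^*(-S)\quad\text{s.t.}\quad\mathcal{A}^*y+\mathcal{F}^*w+S=C.$$ Let $\{(Z^k,X^k)\}$, $Z^k=(y^k,w^k,S^k)$, be an infinite sequence generated by the augmented Lagrangian method (ALM, see context) with positive penalty parameters $c_k\uparrow c_\infty\le\infty$ under the stopping criterion $$(A')\quad\zeta_k(Z^{k+1})-\inf\zeta_k\le\varepsilon_k^2/(2c_k),\qquad\varepsilon_k\ge0,\quad\sum_{k=0}^\infty\varepsilon_k<\infty .$$ (1) The whole sequence $\{X^k\}$ is bounded and converges to some $X^\infty\in\Omega_P$, and for all $k\ge0$, $$\|\mathcal{A}^*y^{k+1}+\mathcal{F}^*w^{k+1}+S^{k+1}-C\|=c_k^{-1}\|X^{k+1}-X^k\|\to0,$$ $$\Psi(Z^{k+1})-\Psi^*\le\zeta_k(Z^{k+1})-\inf\zeta_k+\frac{1}{2c_k}\big(\|X^k\|^2-\|X^{k+1}\|^2\big).$$ Moreover, if the dual problem has a nonempty bounded solution set, then the sequence $\{Z^k\}$ is also bounded, and all of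 its accumulation points are optimal solutions of the dual problem. (2) Suppose in addition that the quadratic growth condition holds at $X^\infty$ with modulus $\kappa_p>0$, i.e. there is $\delta_p>0$ such that $\Phi(X)\ge\Phi(X^\infty)+\kappa_p\,\mathrm{dist}^2(X,\Omega_P)$ for all feasible $X$ (i.e. $\mathcal{A}X\in b+\mathcal{Q}$) with $\|X-X^\infty\|\le\delta_p$, and that the criterion $$(B')\quad\zeta_k(Z^{k+1})-\inf\zeta_k\le\frac{\eta_k^2}{2c_k}\|X^{k+1}-X^k\|^2,\qquad\eta_k\ge0,\quad\sum_{k=0}^\infty\eta_k<\infty$$ is also used. Then there exists $\bar k\ge0$ such that for all $k\ge\bar k$, $$\mathrm{dist}(X^{k+1},\Omega_P)\le\theta_k\,\mathrm{dist}(X^k,\Omega_P),$$ where $\theta_k=(\mu_k+2\eta_k)(1-\eta_k)^{-1}$ with $\mu_k=1/\sqrt{1+c_k^2\kappa_p^2}$, and $\theta_k\to\theta_\infty=1/\sqrt{1+c_\infty^2\kappa_p^2}$ ($\theta_\infty=0$ if $c_\infty=\infty$). In addition, for all $k\ge\bar k$, $$\|\mathcal{A}^*y^{k+1}+\mathcal{F}^*w^{k+1}+S^{k+1}-C\|\le\tau^1_k\,\mathrm{dist}(X^k,\Omega_P),\qquad\Psi(Z^{k+1})-\Psi^*\le\tau^2_k\,\mathrm{dist}(X^k,\Omega_P),$$ where $$\tau^1_k:=c_k^{-1}(1-\eta_k)^{-1}\to\tau^1_\infty=1/c_\infty,\qquad\tau^2_k:=\tau^1_k\big(\eta_k^2\|X^{k+1}-X^k\|+\|X^{k+1}\|+\|X^k\|\big)/2\to\tau^2_\infty=\|X^\infty\|/c_\infty$$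 ($\tau^1_\infty=\tau^2_\infty=0$ if $c_\infty=\infty$).
   Context: Setting. $\mathbb{X}$ is either $\mathbb{R}^{n\times m}$ ($n\le m$) or the space $\mathbb{S}^n$ of real symmetric $n\times n$ matrices, with the trace inner product and the induced norm. $C\in\mathbb{X}$, $b\in\mathbb{R}^e$; $\mathcal{F}:\mathbb{X}\to\mathbb{R}^d$ and $\mathcal{A}:\mathbb{X}\to\mathbb{R}^e$ are linear with adjoints $\mathcal{F}^*,\mathcal{A}^*$; $h:\mathbb{R}^d\to(-\infty,+\infty]$ is convex and continuously differentiable on $\mathrm{dom}\,h$, which is a nonempty open convex set; $\theta:\mathbb{X}\to(-\infty,+\infty]$ is proper closed convex; $\mathcal{Q}\subseteq\mathbb{R}^e$ is a convex polyhedral cone with dual cone $\mathcal{Q}^*=\{y\mid\langle y,z\rangle\ge0\ \forall z\in\mathcal{Q}\}$; $h^*,\theta^*$ are conjugate functions; $\delta_{\mathcal{Q}^*}$ is the indicator function of $\mathcal{Q}^*$. Throughout, the paper assumes the optimal solution sets $\Omega_P$ (primal) and $\Omega_D$ (dual) are nonempty. $\mathrm{dist}$ is the Euclidean distance to a set. Lagrangian functions. $l(Z,X):=\Psi(Z)+\langle X,\mathcal{A}^*y+\mathcal{F}^*w+S-C\rangle$ for $Z=(y,w,S)\in\mathbb{Z}:=\mathbb{R}^e\times\mathbb{R}^d\times\mathbb{X}$, $X\in\mathbb{X}$, and for $c>0$, $L_c(Z,X):=l(Z,X)+\frac c2\|\mathcal{A}^*y+\mathcal{F}^*w+S-C\|^2$.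 The essential objective of the primal problem is $\phi(X):=-\inf_{Z\in\mathbb{Z}}l(Z,X)$, which equals $\Phi(X)$ if $\mathcal{A}X\in b+\mathcal{Q}$ and $+\infty$ otherwise. ALM. Given scalars $0<c_k\uparrow c_\infty\le\infty$ and a starting point $X^0\in\mathbb{X}$, for $k\ge0$ set $\zeta_k(Z):=L_{c_k}(Z,X^k)$, let $Z^{k+1}=(y^{k+1},w^{k+1},S^{k+1})\in\mathbb{Z}$ be an approximate minimizer of $\zeta_k$ over $\mathbb{Z}$ (in the sense of the stated stopping criteria), and set $X^{k+1}:=X^k+c_k(\mathcal{A}^*y^{k+1}+\mathcal{F}^*w^{k+1}+S^{k+1}-C)$.
   Formalization: The function h is additionally assumed closed (lower semicontinuous); without this the claim fails, e.g. h the indicator of (0,1), F = id, θ = 0, C = 0, no constraint, X^0 = 0 gives X^k = 0, which is not in Ω_P. *)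

(* Defs.v *)
From HB Require Import structures.
From mathcomp Require Import all_boot all_order all_algebra.
From mathcomp Require Import all_classical all_reals all_analysis.
Import Order.TTheory GRing.Theory Num.Theory numFieldNormedType.Exports.

Set Implicit Arguments.
Unset Strict Implicit.
Unset Printing Implicit Defensive.

Local Open Scope classical_set_scope.
Local Open Scope ring_scope.

Section Spaces.
Variable R : realType.

Definition symv (n : nat) : {vspace 'M[R]_n} :=
  lker (linfun (@trmx R n n) - \1%VF).

Lemma mem_symv n (A : 'M[R]_n) : (A \in symv n) = (A^T == A).
Proof. by rewrite memv_ker add_lfunE opp_lfunE id_lfunE lfunE /= subr_eq0. Qed.

(* The decision space is the type [subvs_of V] of elements of V. *)
Inductive matrix_space : forall n m : nat, {vspace 'M[R]_(n, m)} -> Prop :=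
  | rect_space n m : (n <= m)%N -> @matrix_space n m fullv
  | sym_space n : @matrix_space n n (symv n).

(* The trace inner product; on column vectors it is the Euclidean one. *)
Definition mxdot n m (A B : 'M[R]_(n, m)) : R := \tr (A^T *m B).
(* The library norm on matrices is the sup norm, hence this definition. *)
Definition mxnorm n m (A : 'M[R]_(n, m)) : R := Num.sqrt (mxdot A A).

Definition Xdot n m (V : {vspace 'M[R]_(n, m)}) (X Y : subvs_of V) : R :=
  mxdot (vsval X) (vsval Y).
Definition Xnorm n m (V : {vspace 'M[R]_(n, m)}) (X : subvs_of V) : R :=
  mxnorm (vsval X).

Definition dist n m (V : {vspace 'M[R]_(n, m)})
    (X : subvs_of V) (S : set (subvs_of V)) : R :=
  inf [set Xnorm (X - Y) | Y in S].

End Spaces.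

Section ConvexAnalysis.
Variable R : realType.
Local Open Scope ereal_scope.

Definition edom (T : Type) (f : T -> \bar R) : set T := [set x | f x < +oo].

Definition convex_efun (E : lmodType R) (f : E -> \bar R) : Prop :=
  forall (x y : E) (t : R), (0 <= t <= 1)%R ->
    f (t *: x + (1 - t) *: y)%R <= t%:E * f x + (1 - t)%:E * f y.

Definition conjugate (T : Type) (ip : T -> T -> R) (f : T -> \bar R) (s : T)
    : \bar R :=
  ereal_sup [set (ip s x)%:E - f x | x in [set: T]].

Definition indicator (T : Type) (K : set T) (x : T) : \bar R :=
  if `[< K x >] then 0 else +oo.

Definition C1_on_dom d (h : 'cV[R]_d -> \bar R) : Prop :=
  forall x, edom h x ->
    differentiable (fun u => fine (h u)) x /\
    forall v, {for x, continuous (fun u => 'D_v (fun z => fine (h z)) u)}.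

Definition polyhedral_cone e (Q : set 'cV[R]_e) : Prop :=
  exists (p : nat) (B : 'M[R]_(p, e)),
    Q = [set z | forall i, (0 <= (B *m z) i 0)%R].

Definition dual_cone e (Q : set 'cV[R]_e) : set 'cV[R]_e :=
  [set y | forall z, Q z -> (0 <= mxdot y z)%R].

End ConvexAnalysis.

Section Problem.
Variables (R : realType) (n m d e : nat) (V : {vspace 'M[R]_(n, m)}).
Local Notation XX := (subvs_of V).

Record problem := Problem {
  pC : XX;
  pb : 'cV[R]_e;
  pF : {linear XX -> 'cV[R]_d};
  pFadj : {linear 'cV[R]_d -> XX};
  pA : {linear XX -> 'cV[R]_e};
  pAadj : {linear 'cV[R]_e -> XX};
  ph : 'cV[R]_d -> \bar R;
  ptheta : XX -> \bar R;
  pQ : set 'cV[R]_e }.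

Variable P : problem.

Record standing_assumptions : Prop := StandingAssumptions {
  adjF : forall X w, mxdot (pF P X) w = Xdot X (pFadj P w);
  adjA : forall X y, mxdot (pA P X) y = Xdot X (pAadj P y);
  h_gtNy : forall x, (-oo < ph P x)%E;
  h_dom0 : edom (ph P) !=set0;
  h_open : open (edom (ph P));
  h_convex : convex_efun (ph P);
  h_C1 : C1_on_dom (ph P);
  (* Not implied by the above: the indicator of an open interval is C1 on its
     open domain. Without it h differs from its biconjugate, and - inf_Z l(Z, X)
     need not be the objective of the primal problem. *)
  h_closed : lower_semicontinuous (ph P);
  theta_gtNy : forall X, (-oo < ptheta P X)%E;
  theta_dom0 : edom (ptheta P) !=set0;
  theta_convex : convex_efun (ptheta P);
  (* XX carries the subspace topology inherited from the matrices. *)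
  theta_closed : lower_semicontinuous
    (ptheta P : initial_topology (vsval : XX -> 'M[R]_(n, m)) -> \bar R);
  Q_polyhedral : polyhedral_cone (pQ P) }.

Definition Phi (X : XX) : \bar R :=
  (ph P (pF P X) + (Xdot (pC P) X)%:E + ptheta P X)%E.

Definition primal_feasible : set XX := [set X | pQ P (pA P X - pb P)].

(* An optimal solution has a finite objective value: argmin is empty when the
   infimum is +oo. *)
Definition OmegaP : set XX :=
  [set X | [/\ primal_feasible X, (Phi X < +oo)%E &
    forall X', primal_feasible X' -> (Phi X <= Phi X')%E]].

Record dualvar := DualVar { zy : 'cV[R]_e; zw : 'cV[R]_d; zS : XX }.

Definition dual_dist (Z Z' : dualvar) : R :=
  Num.sqrt (mxnorm (zy Z - zy Z') ^+ 2 + mxnorm (zw Z - zw Z') ^+ 2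
            + Xnorm (zS Z - zS Z') ^+ 2).

Definition dual_norm (Z : dualvar) : R := dual_dist Z (DualVar 0 0 0).

Definition dual_bounded (S : set dualvar) : Prop :=
  exists M : R, forall Z, S Z -> dual_norm Z <= M.

Definition accumulation_point (Z : nat -> dualvar) (Zbar : dualvar) : Prop :=
  forall eps : R, 0 < eps ->
    forall N, exists2 k, (N <= k)%N & dual_dist (Z k) Zbar < eps.

Definition residual (Z : dualvar) : XX :=
  pAadj P (zy Z) + pFadj P (zw Z) + zS Z - pC P.

Definition Psi (Z : dualvar) : \bar R :=
  (indicator R (dual_cone (pQ P)) (zy Z) - (mxdot (pb P) (zy Z))%:E
   + conjugate (@mxdot R d 1) (ph P) (- zw Z)%R
   + conjugate (@Xdot R n m V) (ptheta P) (- zS Z)%R)%E.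

Definition dual_feasible : set dualvar :=
  [set Z | pAadj P (zy Z) + pFadj P (zw Z) + zS Z = pC P].

Definition Psi_star : \bar R := ereal_inf [set Psi Z | Z in dual_feasible].

Definition OmegaD : set dualvar :=
  [set Z | [/\ dual_feasible Z, (Psi Z < +oo)%E &
    forall Z', dual_feasible Z' -> (Psi Z <= Psi Z')%E]].

Definition lagrangian (Z : dualvar) (X : XX) : \bar R :=
  (Psi Z + (Xdot X (residual Z))%:E)%E.

Definition aug_lagrangian (c : R) (Z : dualvar) (X : XX) : \bar R :=
  (lagrangian Z X + (c / 2 * Xnorm (residual Z) ^+ 2)%:E)%E.

(* zeta_k(Z) - inf zeta_k for zeta_k := L_c(., X). The infimum is finite as soon
   as the primal problem has a solution. *)
Definition subopt (c : R) (X : XX) (Z : dualvar) : \bar R :=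
  (aug_lagrangian c Z X
   - ereal_inf [set aug_lagrangian c Z' X | Z' in [set: dualvar]])%E.

Definition quadratic_growth (Xbar : XX) (kappa : R) : Prop :=
  exists2 delta : R, 0 < delta &
    forall X, primal_feasible X -> Xnorm (X - Xbar) <= delta ->
      (Phi Xbar + (kappa * dist X OmegaP ^+ 2)%:E <= Phi X)%E.

End Problem.

Section Rates.
Variable R : realType.

Definition mu_rate (kappa c : R) : R := 1 / Num.sqrt (1 + c ^+ 2 * kappa ^+ 2).

(* Value at an extended limit cinf in ]0, +oo] of a rate that vanishes at +oo. *)
Definition at_cinf (f : R -> R) (cinf : \bar R) : R :=
  if cinf is c%:E then f c else 0.

End Rates.

(* Main.v *)
Require Import Defs.
From HB Require Import structures.
From mathcomp Require Import all_boot all_order all_algebra.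
From mathcomp Require Import all_classical all_reals all_analysis.
From mathcomp Require Import ring lra.
Import Order.TTheory GRing.Theory Num.Theory numFieldNormedType.Exports.
Set Implicit Arguments.
Unset Strict Implicit.
Unset Printing Implicit Defensive.
Local Open Scope classical_set_scope.
Local Open Scope ring_scope.

(** The augmented Lagrangian method is an inexact proximal point method applied
to the essential objective phi(X) = - inf_Z l(Z, X) of the primal problem, and
every claim follows from this.

The epigraph of Psi is an intersection of half-spaces, so phi is a supremum of
affine functions; it is the primal objective restricted to the feasible set
because h and theta are the suprema of their affine minorants
([affine_minorant]) and a closed convex cone is separated from every point outside it
([dual_cone_separation]); this is [primal_leP]. Minimising L_c(., X) amounts to
minimising p(u) + <X, u> + (c/2) |u|^2 over the residuals u, where p(u) is the
infimum of Psi over all Z with residual u. The quadratic term is finite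
everywhere and strongly convex, so a minimising sequence of residuals converges
to some u, even if no minimising Z exists and no constraint qualification holds
([quad_minimizer]). The first order condition at u says exactly that
Q = X + c u is the proximal point of phi at X and that inf L_c(., X) is minus
the Moreau envelope ([aug_lagrangian_prox]). Strong convexity also turns a
suboptimality sigma of Z into |X + c r - Q|^2 <= 2 c sigma, where r is the
residual of Z: both stopping criteria bound the distance from X^{k+1} to the
exact proximal point Q_k.

The proximal step satisfies |Q - X*|^2 + |Q - X|^2 <= |X - X*|^2 for every
solution X*. With summable errors the distances |X^k - X*| therefore converge,
|Q_k - X^k| tends to 0, every cluster point minimises phi, and then the whole
sequence converges ([inexact_proximal_point]). The bound on the dual objective
is the completion of a square together with inf L_c(., X) <= Psi*, because L_c
and Psi agree on the dual feasible set ([dual_gap_le]). Hence Psi(Z^k)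
exceeds Psi* by at most an error tending to 0 while the residuals tend to 0, so cluster points are dual solutions; if the Z^k were unbounded, pulling them
back towards a dual solution to a fixed large distance would produce, in the
limit, a dual solution outside the bounded solution set
([dual_sequence_bounded]).

For the rate, quadratic growth and the subgradient inequality at Q give
c kappa dist(Q, Omega) <= |Q - X|, and inserting this into the inequality above
gives the contraction factor mu_k ([prox_contraction]); the relative error
criterion only perturbs it ([inexact_contraction]). *)

(** * Finite-dimensional inner product spaces *)

Section EuclideanStructure.
Variable R : realType.

(** Finite dimension enters only through the compactness of balls. It is
expressed along ultrafilters because the same ultrafilter then serves for all
coordinates and for all factors of a product: no nested extraction of
subsequences is needed. *)
Record euclidean (E : lmodType R) (ip : E -> E -> R) : Prop := Euclidean {
  ipC : forall x y, ip x y = ip y x;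
  ipDl : forall x y z, ip (x + y) z = ip x z + ip y z;
  ipZl : forall a x y, ip (a *: x) y = a * ip x y;
  ip_ge0 : forall x, 0 <= ip x x;
  ip_eq0 : forall x, ip x x = 0 -> x = 0;
  ip_compact : forall (U : set_system nat), UltraFilter U ->
    forall (u : nat -> E) M, (forall k, ip (u k) (u k) <= M) ->
    exists x, (fun k => ip (u k - x) (u k - x)) @ U --> (0 : R) }.

Definition enorm (E : lmodType R) (ip : E -> E -> R) (x : E) : R :=
  Num.sqrt (ip x x).

End EuclideanStructure.

Section EuclideanTheory.
Variables (R : realType) (E : lmodType R) (ip : E -> E -> R).
Hypothesis hE : euclidean ip.
Local Notation "<< x , y >>" := (ip x y).
Local Notation nrm := (enorm ip).
Local Notation ipC := (ipC hE).
Local Notation ipDl := (ipDl hE).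
Local Notation ipZl := (ipZl hE).

Lemma ipDr x y z : << x, y + z >> = << x, y >> + << x, z >>.
Proof. by rewrite ipC ipDl !(ipC _ x). Qed.

Lemma ipZr a x y : << x, a *: y >> = a * << x, y >>.
Proof. by rewrite ipC ipZl (ipC y). Qed.

Lemma ipNl x y : << - x, y >> = - << x, y >>.
Proof. by rewrite -scaleN1r ipZl mulN1r. Qed.

Lemma ipNr x y : << x, - y >> = - << x, y >>.
Proof. by rewrite ipC ipNl ipC. Qed.

Lemma ip0l y : << 0, y >> = 0.
Proof. by rewrite -(scale0r 0) ipZl mul0r. Qed.

Lemma ip0r y : << y, 0 >> = 0.
Proof. by rewrite ipC ip0l. Qed.

Definition ipE := (ipDl, ipDr, ipZl, ipZr, ipNl, ipNr, ip0l, ip0r).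

Lemma ip_inj x : (forall y, << y, x >> = 0) -> x = 0.
Proof. by move=> h; apply: (ip_eq0 hE). Qed.

Lemma enorm_ge0 x : 0 <= nrm x.
Proof. exact: sqrtr_ge0. Qed.
Local Hint Resolve enorm_ge0 : core.

Lemma sqr_enorm x : nrm x ^+ 2 = << x, x >>.
Proof. by rewrite sqr_sqrtr // (ip_ge0 hE). Qed.

Lemma enormZ a x : nrm (a *: x) = `|a| * nrm x.
Proof. by rewrite /enorm !ipE mulrA -expr2 sqrtrM ?sqr_ge0 // sqrtr_sqr. Qed.

Lemma enormN x : nrm (- x) = nrm x.
Proof. by rewrite /enorm !ipE opprK. Qed.

Lemma enormB x y : nrm (x - y) = nrm (y - x).
Proof. by rewrite -enormN opprB. Qed.

Lemma cauchy_schwarz x y : `|<< x, y >>| <= nrm x * nrm y.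
Proof.
have [y0|y0] := eqVneq << y, y >> 0.
  by rewrite (ip_eq0 hE y0) ip0r normr0 mulr_ge0.
have yp : 0 < << y, y >> by rewrite lt_def y0 (ip_ge0 hE).
rewrite -sqrtrM ?(ip_ge0 hE) // -sqrtr_sqr ler_sqrt; last first.
  by rewrite mulr_ge0 ?(ip_ge0 hE).
have := ip_ge0 hE (<< y, y >> *: x - << x, y >> *: y).
rewrite !ipE (ipC y x) => h.
have : 0 <= << y, y >> * (<< x, x >> * << y, y >> - << x, y >> ^+ 2) by nra.
by rewrite pmulr_rge0 // subr_ge0.
Qed.

Lemma ip_le x y : << x, y >> <= nrm x * nrm y.
Proof. exact: le_trans (ler_norm _) (cauchy_schwarz _ _). Qed.

Lemma ler_enormD x y : nrm (x + y) <= nrm x + nrm y.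
Proof.
rewrite -(@ler_pXn2r _ 2) ?nnegrE ?addr_ge0 //.
rewrite sqrrD !sqr_enorm !ipE (ipC y x).
have := ip_le x y; lra.
Qed.

Lemma enorm_triangle z x y : nrm (x - y) <= nrm (x - z) + nrm (z - y).
Proof. by rewrite -{1}(subrK z x) -addrA ler_enormD. Qed.

Section Limits.
Variables (T : Type) (F : set_system T) (FF : ProperFilter F).
Variables (u : T -> E) (x : E).
Hypothesis ux : (fun k => nrm (u k - x)) @ F --> (0 : R).

Lemma cvg_ipr s : (fun k => << s, u k >>) @ F --> << s, x >>.
Proof.
apply/cvgrPdist_le => /= eps eps0.
have /cvgrPdist_le /(_ (eps / (nrm s + 1))) : (fun k => nrm (u k - x)) @ F --> (0 : R) := ux.
have s1 : 0 < nrm s + 1 by rewrite ltr_wpDl.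
rewrite divr_gt0 // => /(_ isT); apply: filterS => k.
rewrite sub0r normrN ger0_norm // ler_pdivlMr // => h.
have -> : << s, x >> - << s, u k >> = << s, x - u k >> by rewrite !ipE.
apply: le_trans (cauchy_schwarz _ _) _; rewrite enormB.
by have := enorm_ge0 (u k - x); nra.
Qed.

Lemma cvg_enormB y : (fun k => nrm (u k - y)) @ F --> nrm (x - y).
Proof.
apply/cvgrPdist_le => /= eps eps0.
have /cvgrPdist_le /(_ eps eps0) : (fun k => nrm (u k - x)) @ F --> (0 : R) := ux.
apply: filterS => k; rewrite sub0r normrN ger0_norm // => h.
have h1 := enorm_triangle x (u k) y; have h2 := enorm_triangle (u k) x y.
by rewrite (enormB x (u k)) in h2; rewrite ler_norml; apply/andP; split; lra.
Qed.

End Limits.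

Lemma enorm_compact (U : set_system nat) : UltraFilter U ->
  forall (u : nat -> E) M, (forall k, nrm (u k) <= M) ->
  exists x, (fun k => nrm (u k - x)) @ U --> (0 : R).
Proof.
move=> UU u M hu.
have [k|x hx] := ip_compact hE (u := u) (M := M ^+ 2) UU.
  by rewrite -sqr_enorm ler_pXn2r ?nnegrE // (le_trans _ (hu k)).
exists x; rewrite -sqrtr0.
by apply: (continuous_cvg _ (@sqrt_continuous _ 0)).
Qed.

End EuclideanTheory.

Arguments cvg_ipr {R E ip} hE {T F} FF {u x} ux s.
Arguments cvg_enormB {R E ip} hE {T F} FF {u x} ux y.

(** * Matrices, the decision space, products and the line *)

Section Instances.
Variable R : realType.

Lemma ultra_cvg (U : set_system nat) (u : nat -> R) M : UltraFilter U ->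
  (forall k, u k ^+ 2 <= M) -> exists x : R, u @ U --> x.
Proof.
move=> UU hu.
have UuA : (u @ U) [set` `[- Num.sqrt M, Num.sqrt M]].
  apply: (@filterE _ U) => k /=; rewrite in_itv /= -ler_norml -sqrtr_sqr.
  exact: ler_wsqrtr (hu k).
have := @segment_compact R (- Num.sqrt M) (Num.sqrt M).
have Uu : UltraFilter (u @ U).
  split => [|G PG sUG]; first exact: fmap_proper_filter.
  apply/seteqP; split => // A GA.
  have [//|UC] := @in_ultra_setVsetC _ U (u @^-1` A) _.
  have /(filterI GA) : G (~` A) by apply: sUG.
  by rewrite setICr => /filter_not_empty.
by rewrite compact_ultra => /(_ (u @ U) Uu UuA) [x [_ ux]]; exists x.
Qed.

Lemma cvg_sumr (T : Type) (F : set_system T) (I : finType)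
    (f : I -> T -> R) (l : I -> R) : Filter F ->
  (forall i, f i @ F --> l i) ->
  (fun k => \sum_i f i k) @ F --> \sum_i l i.
Proof.
move=> FF h; elim: (index_enum I) => [|i r IH].
  rewrite big_nil; under eq_fun do rewrite big_nil.
  exact: cvg_cst.
rewrite big_cons; under eq_fun do rewrite big_cons.
exact: cvgD (h i) IH.
Qed.

Lemma mxdotE n m (A B : 'M[R]_(n, m)) :
  mxdot A B = \sum_i \sum_j A j i * B j i.
Proof.
rewrite /mxdot /mxtrace; apply: eq_bigr => i _; rewrite mxE.
by apply: eq_bigr => j _; rewrite mxE.
Qed.

Lemma sqr_coord_le n m (A : 'M[R]_(n, m)) i j : A i j ^+ 2 <= mxdot A A.
Proof.
rewrite mxdotE (bigD1 j) //= (bigD1 i) //= -expr2 -addrA lerDl.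
rewrite addr_ge0 ?sumr_ge0 // => k _; first by rewrite -expr2 sqr_ge0.
by apply: sumr_ge0 => l _; rewrite -expr2 sqr_ge0.
Qed.

Lemma mxdot_euclidean n m : euclidean (@mxdot R n m).
Proof.
split => [x y|x y z|a x y|x|x h|U UU u M hu].
- by rewrite !mxdotE; do 2!apply: eq_bigr => ? _; rewrite mulrC.
- rewrite !mxdotE -big_split; apply: eq_bigr => i _ /=.
  by rewrite -big_split; apply: eq_bigr => j _; rewrite mxE mulrDl.
- rewrite !mxdotE mulr_sumr; apply: eq_bigr => i _ /=.
  by rewrite mulr_sumr; apply: eq_bigr => j _; rewrite mxE mulrA.
- by rewrite mxdotE; do 2!(apply: sumr_ge0 => ? _); rewrite -expr2 sqr_ge0.
- apply/matrixP => i j; rewrite mxE; apply/eqP; rewrite -sqrf_eq0 eq_le sqr_ge0.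
  by rewrite -h sqr_coord_le.
have hc i j : exists x : R, (fun k => u k i j) @ U --> x.
  by apply: (ultra_cvg (M := M)) => k; apply: le_trans (sqr_coord_le _ _ _) (hu k).
pose x := \matrix_(i, j) sval (cid (hc i j)).
exists x; under eq_fun do rewrite mxdotE.
have h0 : \sum_i \sum_j (x j i - x j i) * (x j i - x j i) = 0.
  by rewrite big1 // => i _; rewrite big1 // => j _; rewrite subrr mul0r.
suff : (fun k => \sum_i \sum_j (u k - x) j i * (u k - x) j i) @ U -->
    \sum_i \sum_j (x j i - x j i) * (x j i - x j i) by rewrite h0.
apply: cvg_sumr => i; apply: cvg_sumr => j.
have hx : (fun k => (u k - x) j i) @ U --> x j i - x j i.
  under eq_fun do rewrite 2!mxE; apply: cvgB; last exact: cvg_cst.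
  have -> : x j i = sval (cid (hc j i)) by rewrite mxE.
  exact: (svalP (cid (hc j i))).
exact: (cvgM hx hx).
Qed.

Lemma prod_euclidean (E1 E2 : lmodType R) ip1 ip2 :
  @euclidean R E1 ip1 -> @euclidean R E2 ip2 ->
  euclidean (fun x y : E1 * E2 => ip1 x.1 y.1 + ip2 x.2 y.2).
Proof.
move=> h1 h2; split => [x y|x y z|a x y|x|x h|U UU u M hu].
- by rewrite (ipC h1) (ipC h2).
- by rewrite /= (ipDl h1) (ipDl h2); ring.
- by rewrite /= (ipZl h1) (ipZl h2) mulrDr.
- by rewrite addr_ge0 ?(ip_ge0 h1) ?(ip_ge0 h2).
- have p1 := ip_ge0 h1 x.1; have p2 := ip_ge0 h2 x.2.
  have e1 : ip1 x.1 x.1 = 0 by lra.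
  have e2 : ip2 x.2 x.2 = 0 by lra.
  by rewrite [x]surjective_pairing (ip_eq0 h1 e1) (ip_eq0 h2 e2).
have [k|x1 hx1] := ip_compact h1 (u := fun k => (u k).1) (M := M) UU.
  by apply: le_trans (hu k); rewrite lerDl (ip_ge0 h2).
have [k|x2 hx2] := ip_compact h2 (u := fun k => (u k).2) (M := M) UU.
  by apply: le_trans (hu k); rewrite lerDr (ip_ge0 h1).
by exists (x1, x2); rewrite -[X in _ --> X]addr0; apply: cvgD.
Qed.

Lemma line_euclidean : @euclidean R R^o (fun x y => x * y).
Proof.
split => [x y|x y z|a x y|x|x h|U UU u M hu].
- by rewrite mulrC.
- by rewrite mulrDl.
- by rewrite -mulrA.
- by rewrite -expr2 sqr_ge0.
- by apply/eqP; rewrite -sqrf_eq0 expr2 h.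
have [x ux] : exists x : R, u @ U --> x by apply: (ultra_cvg (M := M)).
exists x; have -> : (0 : R) = (x - x) * (x - x) by rewrite subrr mul0r.
have ? : (fun k => u k - x) @ U --> x - x by apply: cvgB; [exact: ux|exact: cvg_cst].
exact: cvgM.
Qed.

Lemma cvg_mx_coord n m (T : Type) (F : set_system T) (u : T -> 'M[R]_(n, m)) x :
  ProperFilter F -> (fun k => enorm (@mxdot R n m) (u k - x)) @ F --> (0 : R) ->
  forall i j, (fun k => u k i j) @ F --> x i j.
Proof.
move=> FF ux i j; apply/cvgrPdist_le => /= eps eps0.
have /cvgrPdist_le /(_ eps eps0) :
  (fun k => enorm (@mxdot R n m) (u k - x)) @ F --> (0 : R) := ux.
apply: filterS => k; rewrite sub0r normrN ger0_norm ?enorm_ge0 //.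
apply: le_trans; rewrite distrC -sqrtr_sqr ler_wsqrtr //.
by have := sqr_coord_le (u k - x) i j; rewrite !mxE.
Qed.

(** Compactness is inherited from the matrices once the limit lies in the
subspace, and symmetry is a closed condition on the entries. *)
Lemma Xdot_euclidean n m (V : {vspace 'M[R]_(n, m)}) :
  matrix_space V -> euclidean (@Xdot R n m V).
Proof.
move=> hV; have h := mxdot_euclidean n m.
split => [x y|x y z|a x y|x|x e|U UU u M hu].
- exact: (ipC h).
- by rewrite /Xdot linearD (ipDl h).
- by rewrite /Xdot linearZ (ipZl h).
- exact: (ip_ge0 h).
- by apply/val_inj; rewrite /= (ip_eq0 h e).
have [x ux] := ip_compact h (u := fun k => vsval (u k)) UU hu.
have xV : x \in V.
  have ux' : (fun k => enorm (@mxdot R n m) (vsval (u k) - x)) @ U --> (0 : R).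
    by rewrite -sqrtr0; apply: (continuous_cvg _ (@sqrt_continuous _ 0)).
  have {ux'} := @cvg_mx_coord _ _ _ _ _ _ (@ultra_proper _ U UU) ux'.
  case: hV u {hu ux} x => [n' m' _|n'] u x hc; first exact: memvf.
  rewrite mem_symv; apply/eqP/matrixP => i j; rewrite mxE.
  have e : (fun k => vsval (u k) i j) = (fun k => vsval (u k) j i).
    apply/funext => k; have /eqP {2}<- : (vsval (u k))^T == vsval (u k).
      by rewrite -mem_symv subvsP.
    by rewrite mxE.
  have := hc i j; rewrite e => h1.
  exact: (cvg_unique (@Rhausdorff R) (hc j i) h1).
exists (vsproj V x); under eq_fun do rewrite /Xdot linearB /= vsprojK //.
exact: ux.
Qed.

Lemma mx_nbhs_enorm n m (x : 'M[R]_(n, m)) (W : set 'M[R]_(n, m)) :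
  nbhs x W ->
  exists2 del, 0 < del & forall y, enorm (@mxdot R n m) (y - x) < del -> W y.
Proof.
move=> /nbhs_ballP [del /= del0 hW]; exists del => // y hy.
apply: hW; split=> [//|i j]; rewrite /ball /= distrC; apply: le_lt_trans hy.
rewrite -sqrtr_sqr ler_wsqrtr //.
by have := sqr_coord_le (y - x) i j; rewrite !mxE.
Qed.

Definition enorm_lsc (E : lmodType R) (ip : E -> E -> R) (f : E -> \bar R) :=
  forall x a, (a%:E < f x)%E ->
  exists2 del, 0 < del & forall y, enorm ip (y - x) < del -> (a%:E < f y)%E.

Lemma mx_enorm_lsc n m (f : 'M[R]_(n, m) -> \bar R) :
  lower_semicontinuous f -> enorm_lsc (@mxdot R n m) f.
Proof.
move=> hf x a /hf [W /mx_nbhs_enorm [del del0 hW] fW].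
by exists del => // y /hW /fW.
Qed.

Lemma Xdot_enorm_lsc n m (V : {vspace 'M[R]_(n, m)}) (f : subvs_of V -> \bar R) :
  lower_semicontinuous
    (f : initial_topology (vsval : subvs_of V -> 'M[R]_(n, m)) -> \bar R) ->
  enorm_lsc (@Xdot R n m V) f.
Proof.
move=> hf x a /hf [W]; rewrite nbhsE => -[B [[A oA AB] Bx] BW] fW.
have /mx_nbhs_enorm [del del0 hA] : nbhs (vsval x) A.
  by apply: open_nbhs_nbhs; split => //; move: Bx; rewrite -AB.
exists del => // y hy; apply/fW/BW; rewrite -AB /=; apply: hA.
by move: hy; rewrite /enorm /Xdot linearB.
Qed.

End Instances.

(** * Minimisation of a convex function plus a quadratic, and projections *)

Lemma cvg_finer (R : realType) (F G : set_system nat) (u : nat -> R) (l : R) :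
  F `<=` G -> u @ F --> l -> u @ G --> l.
Proof. by move=> FG h A /h; apply: FG. Qed.

Section QuadraticMinimisation.
Variables (R : realType) (E : lmodType R) (ip : E -> E -> R).
Hypothesis hE : euclidean ip.
Local Notation "<< x , y >>" := (ip x y).
Local Notation nrm := (enorm ip).
Local Notation ipC := (ipC hE).
Local Notation ipE := (ipE hE).

Definition quad (X : E) (c : R) (u : E) (a : R) : R :=
  a + << X, u >> + c / 2 * << u, u >>.

(** A relation stands for the epigraph of a convex function that need neither be
closed nor have its infima attained. *)
Definition convex_rel (E0 : lmodType R) (G : E0 -> R -> Prop) : Prop :=
  forall u u' a a' (t : R), 0 <= t <= 1 -> G u a -> G u' a' ->
    G (t *: u + (1 - t) *: u') (t * a + (1 - t) * a').

Lemma quad_mix X c u u' a a' t :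
  quad X c (t *: u + (1 - t) *: u') (t * a + (1 - t) * a') =
  t * quad X c u a + (1 - t) * quad X c u' a'
  - t * (1 - t) * (c / 2) * << u - u', u - u' >>.
Proof. by rewrite /quad !ipE (ipC u' u); field. Qed.

Lemma le_of_shrink (K D : R) :
  (forall t : R, 0 < t <= 1 -> (1 - t) * K <= D) -> K <= D.
Proof.
move=> h; apply/ler_addgt0Pr => e e0.
have K1 : 0 < `|K| + 1 by rewrite ltr_wpDl.
pose t := Num.min 1 (e / (`|K| + 1)).
have t0 : 0 < t by rewrite lt_min ltr01 divr_gt0.
have t1 : t <= 1 by rewrite ge_min lexx.
have := h t; rewrite t0 t1 => /(_ isT) ht.
have : t * (`|K| + 1) <= e by rewrite -ler_pdivlMr // ge_min lexx orbT.
have := ler_norm K; nra.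
Qed.

(** The minimiser us is only a limit of points of the domain, since [G] is not
closed. The identity [quad_mix] at t = 1/2 bounds a minimising sequence; the same
identity on the segment from the sequence to a fixed point (u, a), first along
the sequence and then for t tending to 0, gives the strong convexity inequality
at us, which also forces the sequence itself to converge. *)
Lemma quad_minimizer (G : E -> R -> Prop) (X : E) (c m : R) :
  0 < c -> convex_rel G ->
  (forall u a, G u a -> m <= quad X c u a) ->
  (forall del : R, 0 < del -> exists u a, G u a /\ quad X c u a <= m + del) ->
  exists us,
    (exists u : nat -> E, (forall k, exists a, G (u k) a /\
        quad X c (u k) a <= m + k.+1%:R^-1) /\
      (fun k => nrm (u k - us)) @ \oo --> (0 : R)) /\
    forall u a, G u a -> m + c / 2 * << u - us, u - us >> <= quad X c u a.
Proof.
move=> c0 Gconv Glow Gapp.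
have /choice [ua hua] : forall k : nat, exists p : E * R,
    G p.1 p.2 /\ quad X c p.1 p.2 <= m + k.+1%:R^-1.
  move=> k; have [|u [a h]] := Gapp k.+1%:R^-1; first by rewrite invr_gt0.
  by exists (u, a).
pose u k := (ua k).1; pose a k := (ua k).2.
have hG k : G (u k) (a k) by have [] := hua k.
have hq k : quad X c (u k) (a k) <= m + k.+1%:R^-1 by have [] := hua k.
have mix u' a' (t : R) k : 0 <= t <= 1 -> G u' a' ->
    m + t * (1 - t) * (c / 2) * << u' - u k, u' - u k >> <=
    t * quad X c u' a' + (1 - t) * (m + k.+1%:R^-1).
  move=> t01 Gu'.
  have := Glow _ _ (Gconv _ _ _ _ _ t01 Gu' (hG k)); rewrite quad_mix.
  have := hq k; case/andP: t01 => t0 t1.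
  move=> h1 h2; have : 0 <= (1 - t) * (m + k.+1%:R^-1 - quad X c (u k) (a k)).
    by rewrite mulr_ge0 ?subr_ge0.
  by move: h2; move: (k.+1%:R^-1) => z; lra.
have k1 k : k.+1%:R^-1 <= 1 :> R by rewrite invf_le1 // ler1n.
have bnd k : nrm (u k) <= nrm (u 0%N) + Num.sqrt (8 / c).
  (* Both values are at most m + 1 and their midpoint value is at least m. *)
  have : nrm (u 0%N - u k) <= Num.sqrt (8 / c).
    rewrite ler_wsqrtr // ler_pdivlMr //.
    have := mix _ _ (1 / 2) k _ (hG 0%N).
    have := hq 0%N; have := k1 0%N; have := k1 k.
    move: (k.+1%:R^-1) (1%:R^-1) => z z1.
    set N := << _, _ >>; move=> ? ? ? h; have : 0 <= (1 / 2 : R) <= 1 by lra.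
    by move=> /h; lra.
  have := enorm_triangle hE (u 0%N) (u k) 0; rewrite !subr0.
  by rewrite (enormB hE (u k)); lra.
have [U [UU sU]] := @ultraFilterLemma nat \oo _.
have [us hus] := enorm_compact hE UU bnd.
have strong u' a' : G u' a' ->
    m + c / 2 * << u' - us, u' - us >> <= quad X c u' a'.
  move=> Gu'; rewrite -lerBrDl; apply: le_of_shrink => t /andP[t0 t1].
  have lhs : (fun k => m + t * (1 - t) * (c / 2) * nrm (u k - u') ^+ 2) @ U -->
      m + t * (1 - t) * (c / 2) * nrm (us - u') ^+ 2.
    apply: cvgD; first exact: cvg_cst.
    apply: cvgM; first exact: cvg_cst.
    by apply: cvgM; apply: (cvg_enormB hE _ hus _).
  have rhs : (fun k => t * quad X c u' a' + (1 - t) * (m + k.+1%:R^-1)) @ U -->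
      t * quad X c u' a' + (1 - t) * (m + 0).
    apply: cvgD; first exact: cvg_cst.
    apply: cvgM; first exact: cvg_cst.
    apply: cvgD; first exact: cvg_cst.
    exact: (cvg_finer sU (@cvg_harmonic R)).
  have : m + t * (1 - t) * (c / 2) * nrm (us - u') ^+ 2 <=
      t * quad X c u' a' + (1 - t) * (m + 0).
    apply: (ler_cvg_to lhs rhs); apply: filterE => k.
    rewrite (enormB hE) sqr_enorm //; apply: mix => //; lra.
  by rewrite (enormB hE) sqr_enorm // => h; rewrite -(ler_pM2l t0); lra.
exists us; split => //; exists u; split; first by move=> k; exists (a k).
have sq : (fun k => Num.sqrt (2 / c * k.+1%:R^-1)) @ \oo --> (0 : R).
  rewrite -sqrtr0; apply: (continuous_cvg _ (@sqrt_continuous _ 0)).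
  rewrite -[X in _ --> X](mulr0 (2 / c)); apply: cvgM; first exact: cvg_cst.
  exact: cvg_harmonic.
apply: (squeeze_cvgr _ (cvg_cst (0 : R)) sq); apply: filterE => k.
rewrite enorm_ge0 /= ler_wsqrtr // mulrAC ler_pdivlMr //.
by have := strong _ _ (hG k); have := hq k; move: (k.+1%:R^-1) => z; lra.
Qed.

Definition enorm_closed (S : set E) : Prop :=
  forall x, (forall del : R, 0 < del -> exists2 y, S y & nrm (y - x) < del) -> S x.

Definition segment_stable (S : set E) : Prop :=
  forall x y (t : R), 0 <= t <= 1 -> S x -> S y -> S (t *: x + (1 - t) *: y).

(** Up to an additive constant, [quad] with the linear term - x0 and modulus 1 is
half the squared distance to x0. *)
Lemma projection (S : set E) (x0 : E) :
  S !=set0 -> segment_stable S -> enorm_closed S ->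
  exists2 p, S p & forall x, S x -> << x0 - p, x - p >> <= 0.
Proof.
move=> [s0 Ss0] Sconv Scl.
pose G (u : E) (a : R) := S u /\ a = 0.
pose Q := [set quad (- x0) 1 u 0 | u in S].
have q_ge u : - (<< x0, x0 >> / 2) <= quad (- x0) 1 u 0.
  have := ip_ge0 hE (u - x0); rewrite /quad !ipE (ipC u x0); lra.
have Qinf : has_inf Q.
  by split; [exists (quad (- x0) 1 s0 0), s0|exists (- (<< x0, x0 >> / 2)) => _ [u _ <-]].
have [] := @quad_minimizer G (- x0) 1 (inf Q) ltr01.
- move=> u u' a a' t t01 [Su ->] [Su' ->]; split; first exact: Sconv.
  by rewrite !mulr0 addr0.
- by move=> u a [Su ->]; apply: ge_inf; [case: Qinf|exists u].
- move=> del del0; have [_ [u Su <-] h] := inf_adherent del0 Qinf.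
  by exists u, 0; split => //; exact: ltW.
move=> p [[u [hu up]] strong].
have Sp : S p.
  apply: Scl => del del0; move/cvgrPdist_lt : up => /(_ _ del0) [N _ /(_ N)].
  rewrite /= leqnn sub0r normrN ger0_norm ?enorm_ge0 // => /(_ isT) h.
  by exists (u N) => //; have [a [[]]] := hu N.
have qp : quad (- x0) 1 p 0 <= inf Q.
  have l1 : (fun k => 0 + << - x0, u k >> + 1 / 2 * nrm (u k - 0) ^+ 2) @ \oo -->
      0 + << - x0, p >> + 1 / 2 * nrm (p - 0) ^+ 2.
    apply: cvgD; first by apply: cvgD; [exact: cvg_cst|exact: (cvg_ipr hE _ up _)].
    by apply: cvgM; [exact: cvg_cst|apply: cvgM; apply: (cvg_enormB hE _ up _)].
  have l2 : (fun k => inf Q + k.+1%:R^-1) @ \oo --> inf Q + 0.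
    by apply: cvgD; [exact: cvg_cst|exact: cvg_harmonic].
  have := ler_cvg_to l1 l2; rewrite addr0 !subr0 sqr_enorm //; apply.
  apply: filterE => k; have [a [[_ ->]]] := hu k.
  by rewrite subr0 sqr_enorm.
exists p => // x Sx; have := strong x 0 (conj Sx erefl); move: qp.
rewrite /quad !ipE (ipC x p); lra.
Qed.

End QuadraticMinimisation.

(** * Separation: affine minorants and polyhedral cones *)

Section FenchelMoreau.
Variables (R : realType) (E : lmodType R) (ip : E -> E -> R).
Hypothesis hE : euclidean ip.
Local Notation "<< x , y >>" := (ip x y).

Lemma lt_EFin_gap (x : \bar R) (a : R) : (a%:E < x)%E ->
  exists2 e, 0 < e & ((a + e)%:E < x)%E.
Proof.
case: x => [r| |] //=; rewrite ?lte_fin => h.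
- by exists ((r - a) / 2); rewrite ?lte_fin; lra.
- by exists 1; rewrite ?ltry.
Qed.

(** Project (x0, alpha) onto the epigraph, obtaining (p, beta) with
beta >= alpha. The normal is (x0 - p, alpha - beta): if beta > alpha the
separating hyperplane is the graph of an affine minorant that exceeds alpha at
x0, otherwise it is vertical and only separates x0 from the domain. *)
Lemma epigraph_separation (f : E -> \bar R) :
  (forall x, (-oo < f x)%E) -> edom f !=set0 -> convex_efun f ->
  enorm_lsc ip f ->
  forall x0 alpha, (alpha%:E < f x0)%E ->
  (exists s tau, (forall x, ((<< s, x >> - tau)%:E <= f x)%E) /\
     alpha < << s, x0 >> - tau) \/
  (exists2 p, (f p <= alpha%:E)%E &
     forall x, edom f x -> << x0 - p, x - p >> <= 0).
Proof.
move=> fN [x1 dx1] fconv flsc x0 alpha hx0.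
have hP := prod_euclidean hE (line_euclidean R).
pose ipP (x y : E * R^o) := ip x.1 y.1 + x.2 * y.2.
pose epi := [set p : E * R^o | (f p.1 <= p.2%:E)%E].
have ffin x : edom f x -> f x = (fine (f x))%:E.
  by move=> dx; rewrite fineK // fin_numE gt_eqF ?fN // lt_eqF.
have epi0 : epi !=set0 by exists (x1, fine (f x1)); rewrite /epi /= -ffin.
have epiC : segment_stable epi.
  move=> [x a] [y b] t /= hx hy t01; rewrite /epi /=.
  apply: le_trans (fconv _ _ _ hx) _.
  case/andP: hx => t0 t1.
  apply: (@le_trans _ _ (t%:E * (a : R)%:E + (1 - t)%:E * (b : R)%:E)%E) => //.
  by apply: leeD; rewrite lee_wpmul2l // lee_fin subr_ge0.
have epicl : enorm_closed ipP epi.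
  move=> [x a] h; rewrite /epi /= leNgt; apply/negP => /lt_EFin_gap [e e0].
  move=> /flsc [del del0 hdel].
  have [|[y b] /= hyb hn] := h (Num.min del e); first by rewrite lt_min del0.
  move: hn; rewrite lt_min => /andP[hn1 hn2].
  have : (f y <= b%:E)%E := hyb; rewrite leNgt => /negP; apply.
  apply: le_lt_trans (hdel y _); last first.
    apply: le_lt_trans hn1; rewrite ler_wsqrtr // /ipP /= lerDl.
    by rewrite -expr2 sqr_ge0.
  rewrite lee_fin -lerBlDl; apply: le_trans (ler_norm _) _.
  apply/ltW/(le_lt_trans _ hn2); rewrite -sqrtr_sqr ler_wsqrtr // expr2.
  by rewrite /ipP /= lerDr (ip_ge0 hE).
have [[p be] hpb sep] := projection hP (x0, alpha) epi0 epiC epicl.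
have {}sep x t : (f x <= t%:E)%E ->
    << x0 - p, x - p >> + (alpha - be) * (t - be) <= 0.
  by move=> h; exact: (sep (x, t) h).
have fp : (f p <= be%:E)%E := hpb.
have := sep p (be + 1) (le_trans fp _); rewrite lee_fin lerDl ler01 => /(_ isT).
rewrite subrr (ip0r hE) add0r addrAC subrr add0r mulr1 subr_le0 le_eqVlt => /orP[/eqP e|w].
  right; exists p; first by rewrite e.
  move=> x dx; have := sep x (fine (f x)); rewrite -ffin // => /(_ (lexx _)).
  by rewrite e subrr mul0r addr0.
left; have w0 : 0 < be - alpha by rewrite subr_gt0.
exists ((be - alpha)^-1 *: (x0 - p)), (<< (be - alpha)^-1 *: (x0 - p), p >> - be).
have aff x : << (be - alpha)^-1 *: (x0 - p), x >> -
    (<< (be - alpha)^-1 *: (x0 - p), p >> - be) =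
    (be - alpha)^-1 * << x0 - p, x - p >> + be.
  by rewrite !(ipE hE); ring.
split=> [x|]; last first.
  by rewrite aff ltr_wpDl // mulr_ge0 ?invr_ge0 ?(ip_ge0 hE) // ltW.
rewrite aff; have := fN x; case fx: (f x) => [r| |] // _; last by rewrite leey.
rewrite lee_fin -lerBrDr ler_pdivrMl //.
have := sep x r; rewrite fx => /(_ (lexx _)); lra.
Qed.

(** The Fenchel-Moreau theorem in the form used here: f is the supremum of its
affine minorants. A vertical hyperplane at x0 is added with a large weight to
some affine minorant, and one exists because over a point of the domain the
separating hyperplane cannot be vertical. *)
Lemma affine_minorant (f : E -> \bar R) :
  (forall x, (-oo < f x)%E) -> edom f !=set0 -> convex_efun f ->
  enorm_lsc ip f ->
  forall x0 alpha, (alpha%:E < f x0)%E ->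
  exists s tau, (forall x, ((<< s, x >> - tau)%:E <= f x)%E) /\
    alpha < << s, x0 >> - tau.
Proof.
move=> fN f0 fconv flsc x0 alpha hx0.
have sep := epigraph_separation fN f0 fconv flsc.
case: (sep _ _ hx0) => // -[p fp hp].
have [x1 dx1] := f0.
have fx1 : f x1 = (fine (f x1))%:E.
  by rewrite fineK // fin_numE gt_eqF ?fN // lt_eqF.
have [|[s1 [tau1 [min1 _]]]|[q fq hq]] := sep x1 (fine (f x1) - 1).
- by rewrite [in X in (_ < X)%E]fx1 lte_fin ltrBlDr ltrDl.
- have px : 0 < << x0 - p, x0 - p >>.
    rewrite lt_def (ip_ge0 hE) andbT; apply/eqP => /(ip_eq0 hE) /eqP.
    by rewrite subr_eq0 => /eqP e; move: hx0; rewrite e ltNge fp.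
  pose la := (`|alpha - (<< s1, x0 >> - tau1)| + 1) / << x0 - p, x0 - p >>.
  have la0 : 0 <= la by rewrite divr_ge0 ?addr_ge0 // ltW.
  exists (s1 + la *: (x0 - p)), (tau1 + la * << x0 - p, p >>).
  have aff x : << s1 + la *: (x0 - p), x >> - (tau1 + la * << x0 - p, p >>) =
      << s1, x >> - tau1 + la * << x0 - p, x - p >>.
    by rewrite !(ipE hE); ring.
  split=> [x|]; last first.
    rewrite aff /la divfK ?gt_eqF //.
    have := ler_norm (alpha - (<< s1, x0 >> - tau1)); lra.
  rewrite aff; have [fx|] := ltP (f x) +oo%E; last by rewrite leye_eq => /eqP ->; rewrite leey.
  apply: le_trans (min1 x); rewrite lee_fin gerDl.
  by rewrite mulr_ge0_le0 // hp.
- have := hq _ dx1; have := ip_ge0 hE (x1 - q) => h1 h2.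
  have /(ip_eq0 hE)/eqP : << x1 - q, x1 - q >> = 0 by apply/eqP; rewrite eq_le h1 h2.
  rewrite subr_eq0 => /eqP e; move: fq; rewrite -e fx1 lee_fin; lra.
Qed.

End FenchelMoreau.

Section PolyhedralCone.
Variables (R : realType) (e : nat).
Let he := mxdot_euclidean R e 1.

Lemma polyhedral_cone0 (Q : set 'cV[R]_e) : polyhedral_cone Q -> Q 0.
Proof. by move=> [p [B ->]] i; rewrite mulmx0 mxE. Qed.

Lemma polyhedral_coneZ (Q : set 'cV[R]_e) t v :
  polyhedral_cone Q -> 0 <= t -> Q v -> Q (t *: v).
Proof.
move=> [p [B ->]] t0 h i; rewrite -scalemxAr mxE mulr_ge0 //; exact: h.
Qed.

Lemma polyhedral_cone_convex (Q : set 'cV[R]_e) :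
  polyhedral_cone Q -> segment_stable Q.
Proof.
move=> [p [B ->]] u v t /andP[t0 t1] hu hv i.
rewrite mulmxDr -!scalemxAr mxE.
by apply: addr_ge0; rewrite mxE; apply: mulr_ge0; rewrite ?subr_ge0.
Qed.

Lemma polyhedral_cone_closed (Q : set 'cV[R]_e) :
  polyhedral_cone Q -> enorm_closed (@mxdot R e 1) Q.
Proof.
move=> [p [B ->]] v hv i.
have rowE w : (B *m w) i 0 = mxdot (row i B)^T w.
  by rewrite /mxdot trmxK -row_mul /mxtrace big_ord1 [RHS]mxE.
rewrite rowE leNgt; apply/negP => neg.
have r0 : 0 < enorm (@mxdot R e 1) (row i B)^T + 1.
  by rewrite ltr_wpDl // enorm_ge0.
have [|w hw wv] := hv (- mxdot (row i B)^T v / (enorm (@mxdot R e 1) (row i B)^T + 1)).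
  by rewrite divr_gt0 // oppr_gt0.
move: wv; rewrite ltr_pdivlMr // => wv.
have := hw i; rewrite rowE.
have -> : w = (w - v) + v by rewrite subrK.
have := ip_le he (row i B)^T (w - v); rewrite (ipDr he).
have := enorm_ge0 (@mxdot R e 1) (w - v); nra.
Qed.

(** The vector from q to its projection onto [Q] lies in the dual cone: testing
the projection inequality at 0 and at twice the projection shows that it is
orthogonal to the projection. *)
Lemma dual_cone_separation (Q : set 'cV[R]_e) q : polyhedral_cone Q -> ~ Q q ->
  exists2 y, dual_cone Q y & mxdot q y < 0.
Proof.
move=> hQ nQ.
have [p Qp sep] := projection he q (ex_intro _ 0 (polyhedral_cone0 hQ))
  (polyhedral_cone_convex hQ) (polyhedral_cone_closed hQ).
have o : mxdot (q - p) p = 0.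
  have := sep _ (polyhedral_cone0 hQ).
  have := sep _ (polyhedral_coneZ (t := 2) hQ (ler0n _ _) Qp).
  rewrite !(ipE he); lra.
exists (p - q) => [v Qv|].
  by have := sep v Qv; move: o; rewrite !(ipE he); lra.
have : 0 < mxdot (q - p) (q - p).
  rewrite lt_def (ip_ge0 he) andbT; apply/eqP => /(ip_eq0 he)/eqP.
  by rewrite subr_eq0 => /eqP e0; apply: nQ; rewrite e0.
move: o; rewrite !(ipE he) (ipC he p q); lra.
Qed.

End PolyhedralCone.

(** * The dual objective and the essential primal objective *)

Section Conjugate.
Variables (R : realType) (T : Type) (ip : T -> T -> R) (f : T -> \bar R).
Hypothesis fN : forall x, (-oo < f x)%E.

Lemma edom_fineK x : edom f x -> f x = (fine (f x))%:E.
Proof. by move=> dx; rewrite fineK // fin_numE gt_eqF ?fN // lt_eqF. Qed.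

Lemma conjugate_leP s (a : R) : (conjugate ip f s <= a%:E)%E <->
  forall x, edom f x -> ip s x - fine (f x) <= a.
Proof.
split=> [h x dx|h].
  rewrite -lee_fin; apply: le_trans h; apply: ereal_sup_ubound.
  by exists x => //; rewrite EFinB -edom_fineK.
apply: ge_ereal_sup => _ [x _ <-].
have [dx|] := ltP (f x) +oo%E.
  by rewrite edom_fineK // -EFinB lee_fin; apply: h.
by rewrite leye_eq => /eqP ->; rewrite addeNy leNye.
Qed.

Lemma conjugate_gtNy s : edom f !=set0 -> (-oo < conjugate ip f s)%E.
Proof.
move=> [x dx]; apply: (@lt_le_trans _ _ (ip s x - fine (f x))%:E).
  exact: ltNyr.
by apply: ereal_sup_ubound; exists x => //; rewrite EFinB -edom_fineK.
Qed.

End Conjugate.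

Lemma ereal_sum_le (R : realType) (x y : \bar R) (r b : R) : (-oo < x)%E -> (-oo < y)%E ->
  (forall a1 a2, (a1%:E < x)%E -> (a2%:E < y)%E -> a1 + r + a2 <= b) ->
  (x + r%:E + y <= b%:E)%E.
Proof.
have below (z : \bar R) : (-oo < z)%E -> exists a : R, (a%:E < z)%E.
  case: z => [t| |] // _; last by exists 0; rewrite ltry.
  by exists (t - 1); rewrite lte_fin; lra.
move=> x0 y0 h; have [a1 h1] := below x x0; have [a2 h2] := below y y0.
case: x x0 h h1 => [s| |] // _ h h1; last first.
  by exfalso; have := h (b - r - a2 + 1) a2; rewrite ltry => /(_ isT h2); lra.
case: y y0 h h2 => [t| |] // _ h h2; last first.
  by exfalso; have := h a1 (b - r - a1 + 1); rewrite ltry => /(_ h1 isT); lra.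
rewrite -!EFinD lee_fin leNgt; apply/negP => lt.
have := h (s - (s + r + t - b) / 3)%R (t - (s + r + t - b) / 3)%R.
have l3 : forall x, (x - (s + r + t - b) / 3 < x)%R by move=> x; lra.
by rewrite !lte_fin !l3 => /(_ isT isT); lra.
Qed.

Section DualFunction.
Variables (R : realType) (n m d e : nat) (V : {vspace 'M[R]_(n, m)}).
Hypothesis hV : matrix_space V.
Variable P : problem d e V.
Hypothesis hP : standing_assumptions P.
Local Notation XX := (subvs_of V).
Local Notation ZZ := ('cV[R]_e * 'cV[R]_d * XX)%type.

Definition dpack (z : ZZ) : dualvar d e V := DualVar z.1.1 z.1.2 z.2.
Definition dunpack (Z : dualvar d e V) : ZZ := (zy Z, zw Z, zS Z).

Lemma dunpackK Z : dpack (dunpack Z) = Z.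
Proof. by case: Z. Qed.

Lemma dpackK z : dunpack (dpack z) = z.
Proof. by case: z => [[]]. Qed.

Definition Zdot (z z' : ZZ) : R :=
  mxdot z.1.1 z'.1.1 + mxdot z.1.2 z'.1.2 + Xdot z.2 z'.2.

Lemma Zdot_euclidean : euclidean Zdot.
Proof.
exact: (prod_euclidean (prod_euclidean (mxdot_euclidean R e 1)
  (mxdot_euclidean R d 1)) (Xdot_euclidean hV)).
Qed.

Let hX := Xdot_euclidean hV.
Let he := mxdot_euclidean R e 1.
Let hd := mxdot_euclidean R d 1.

Lemma Xdot_residual X z : Xdot X (residual P (dpack z)) =
  Zdot (pA P X, pF P X, X) z - Xdot (pC P) X.
Proof.
rewrite /residual /Zdot /= (adjA hP) (adjF hP) !(ipE hX).
by rewrite (ipC hX X (pC P)).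
Qed.

(** The sublevel condition is a family of affine inequalities in (Z, a), so
convexity and closedness of the dual objective can be read off. Taking the
two suprema jointly over pairs (x, X) avoids sums of infinite values. *)
Lemma Psi_leP z (a : R) : (Psi P (dpack z) <= a%:E)%E <->
  (forall v, pQ P v -> 0 <= Zdot (v, 0, 0) z) /\
  (forall x X, edom (ph P) x -> edom (ptheta P) X ->
     Zdot (- pb P, - x, - X) z - fine (ph P x) - fine (ptheta P X) <= a).
Proof.
have hN := h_gtNy hP; have tN := theta_gtNy hP.
have cone : dual_cone (pQ P) z.1.1 <-> forall v, pQ P v -> 0 <= Zdot (v, 0, 0) z.
  by split=> h v /h; rewrite /Zdot /= (ip0l hd) (ip0l hX) !addr0 (ipC he).
rewrite -cone /Psi /= /indicator; case: asboolP => yQ; last first.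
  split=> [|[]//].
  have := conjugate_gtNy (@mxdot R d 1) hN (- z.1.2) (h_dom0 hP).
  have := conjugate_gtNy (@Xdot R n m V) tN (- z.2) (theta_dom0 hP).
  case: (conjugate (@Xdot R n m V) _ _) => [r| |] // _;
  case: (conjugate (@mxdot R d 1) _ _) => [r'| |] //.
have aff x X : Zdot (- pb P, - x, - X) z - fine (ph P x) - fine (ptheta P X) =
  - mxdot (pb P) z.1.1 + (mxdot (- z.1.2) x - fine (ph P x))
  + (Xdot (- z.2) X - fine (ptheta P X)).
  rewrite /Zdot /= (ipNl he) !(ipNl hd) !(ipNl hX) (ipC hd x) (ipC hX X); ring.
rewrite add0e.
split=> [|[_ h]].
  have := conjugate_gtNy (@mxdot R d 1) hN (- z.1.2) (h_dom0 hP).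
  have := conjugate_gtNy (@Xdot R n m V) tN (- z.2) (theta_dom0 hP).
  case E2: (conjugate (@Xdot R n m V) _ _) => [r2| |] // _;
  case E1: (conjugate (@mxdot R d 1) _ _) => [r1| |] // _ h.
  split=> // x X dx dX; rewrite aff.
  have /(conjugate_leP _ hN)/(_ _ dx) :
    (conjugate (@mxdot R d 1) (ph P) (- z.1.2)%R <= r1%:E)%E by rewrite E1.
  have /(conjugate_leP _ tN)/(_ _ dX) :
    (conjugate (@Xdot R n m V) (ptheta P) (- z.2)%R <= r2%:E)%E by rewrite E2.
  by move: h; rewrite -!EFinD lee_fin; lra.
have [X0 dX0] := theta_dom0 hP.
have key X : edom (ptheta P) X ->
    (conjugate (@mxdot R d 1) (ph P) (- z.1.2)%R <=
     (a + mxdot (pb P) z.1.1 - (Xdot (- z.2) X - fine (ptheta P X)))%:E)%E.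
  move=> dX; apply/(conjugate_leP _ hN) => x dx.
  by have := h x X dx dX; rewrite aff; lra.
have := conjugate_gtNy (@mxdot R d 1) hN (- z.1.2) (h_dom0 hP).
have := key X0 dX0; case E1: (conjugate (@mxdot R d 1) _ _) => [r1| |] // _ _.
have : (conjugate (@Xdot R n m V) (ptheta P) (- z.2)%R <=
    (a + mxdot (pb P) z.1.1 - r1)%:E)%E.
  apply/(conjugate_leP _ tN) => X dX.
  by have := key X dX; rewrite E1 lee_fin; lra.
move=> h2; apply: le_trans (leeD (lexx _) h2) _.
by rewrite -!EFinD lee_fin; lra.
Qed.

Lemma Psi_gtNy z : (-oo < Psi P (dpack z))%E.
Proof.
rewrite ltNge leeNy_eq; apply/negP => /eqP h.
have [x dx] := h_dom0 hP; have [X dX] := theta_dom0 hP.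
pose r := Zdot (- pb P, - x, - X) z - fine (ph P x) - fine (ptheta P X).
have /Psi_leP [_ /(_ _ _ dx dX)] : (Psi P (dpack z) <= (r - 1)%:E)%E.
  by rewrite h leNye.
rewrite -/r; lra.
Qed.

Lemma Psi_convex : convex_rel (fun z a => (Psi P (dpack z) <= a%:E)%E).
Proof.
have hZ := Zdot_euclidean.
move=> u u' a a' t /andP[t0 t1] /Psi_leP [h1 h2] /Psi_leP [h1' h2'].
have t1' : 0 <= 1 - t by rewrite subr_ge0.
apply/Psi_leP; split=> [v Qv|x X dx dX].
  by rewrite !(ipE hZ) addr_ge0 // mulr_ge0 // ?h1 ?h1'.
rewrite !(ipE hZ).
have := ler_wpM2l t0 (h2 x X dx dX); have := ler_wpM2l t1' (h2' x X dx dX).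
lra.
Qed.

Lemma Psi_closed (F : set_system nat) (z : nat -> ZZ) (a : nat -> R) z0 (a0 : R) :
  ProperFilter F ->
  (fun k => enorm Zdot (z k - z0)) @ F --> (0 : R) -> a @ F --> a0 ->
  (forall k, (Psi P (dpack (z k)) <= (a k)%:E)%E) ->
  (Psi P (dpack z0) <= a0%:E)%E.
Proof.
have hZ := Zdot_euclidean.
move=> FF zz aa h; apply/Psi_leP; split=> [v Qv|x X dx dX].
  apply: (cvgr_to_ge (cvg_ipr hZ FF zz (v, 0, 0))).
  by apply: filterE => k; have /Psi_leP [/(_ _ Qv)] := h k.
set s := (- pb P, - x, - X).
have l : (fun k => Zdot s (z k) - fine (ph P x) - fine (ptheta P X)) @ F -->
    Zdot s z0 - fine (ph P x) - fine (ptheta P X).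
  exact: (cvgB (cvgB (cvg_ipr hZ FF zz s) (cvg_cst _)) (cvg_cst _)).
apply: (ler_cvg_to l aa); apply: filterE => k.
by have /Psi_leP [_ /(_ _ _ dx dX)] := h k.
Qed.

(** With phi(X) = - inf_Z l(Z, X), this is the inequality phi(X) <= b. *)
Definition primal_le (X : XX) (b : R) : Prop :=
  forall z a, (Psi P (dpack z) <= a%:E)%E ->
    - a - Xdot X (residual P (dpack z)) <= b.

Lemma affine_minorant_Psi s1 tau1 s2 tau2 y :
  (forall x, ((mxdot s1 x - tau1)%:E <= ph P x)%E) ->
  (forall X, ((Xdot s2 X - tau2)%:E <= ptheta P X)%E) ->
  dual_cone (pQ P) y ->
  (Psi P (dpack (y, - s1, - s2)%R) <= (tau1 + tau2 - mxdot (pb P) y)%:E)%E.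
Proof.
move=> m1 m2 yQ; apply/Psi_leP; split=> [v Qv|x X dx dX].
  rewrite /Zdot /= (ip0l hd) (ip0l hX) !addr0 (ipC he); exact: yQ.
have := m1 x; rewrite (edom_fineK (h_gtNy hP) dx) lee_fin.
have := m2 X; rewrite (edom_fineK (theta_gtNy hP) dX) lee_fin.
rewrite /Zdot /= (ipNl he) !(ipE hd) !(ipE hX) (ipC hd x) (ipC hX X).
lra.
Qed.

(** The implication from right to left is weak duality. Conversely, Z is built
from affine minorants of h and theta, whose values at X come arbitrarily close to
those of h and theta; if X is infeasible, adding a large multiple of an element
of the dual cone that separates makes - l(Z, X) unbounded. *)
Lemma primal_leP X b : primal_le X b <->
  primal_feasible P X /\ (Phi P X <= b%:E)%E.
Proof.
have hN := h_gtNy hP; have tN := theta_gtNy hP.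
have hmin := affine_minorant hd hN (h_dom0 hP) (h_convex hP)
  (mx_enorm_lsc (h_closed hP)).
have tmin := affine_minorant hX tN (theta_dom0 hP) (theta_convex hP)
  (Xdot_enorm_lsc (theta_closed hP)).
split=> [h|[fX PX] z a]; last first.
  have : edom (ph P) (pF P X) /\ edom (ptheta P) X.
    move: PX (hN (pF P X)) (tN X); rewrite /Phi /edom /=.
    by case: (ph P (pF P X)) => [r1| |] //; case: (ptheta P X) => [r2| |] //;
      rewrite ?ltry.
  move=> [dF dX] /Psi_leP [h1 h2]; have {}h1 := h1 _ fX; have {}h2 := h2 _ _ dF dX.
  move: PX; rewrite /Phi (edom_fineK hN dF) (edom_fineK tN dX) -!EFinD lee_fin.
  move: h1 h2; rewrite Xdot_residual /Zdot /= !(ipE he) !(ipE hd) !(ipE hX).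
  lra.
have bound s1 tau1 s2 tau2 y :
    (forall x, ((mxdot s1 x - tau1)%:E <= ph P x)%E) ->
    (forall X, ((Xdot s2 X - tau2)%:E <= ptheta P X)%E) ->
    dual_cone (pQ P) y ->
    mxdot s1 (pF P X) - tau1 + Xdot (pC P) X + (Xdot s2 X - tau2)
    - mxdot (pA P X - pb P) y <= b.
  move=> m1 m2 yQ; have := h _ _ (affine_minorant_Psi m1 m2 yQ).
  rewrite Xdot_residual /Zdot /= (ipC hd s1) (ipC hX s2).
  by rewrite !(ipE he) !(ipE hd) !(ipE hX); lra.
have [x0 dx0] := h_dom0 hP; have [X0 dX0] := theta_dom0 hP.
split; last first.
  apply: ereal_sum_le => // a1 a2 /hmin [s1 [t1 [m1 l1]]] /tmin [s2 [t2 [m2 l2]]].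
  have := bound s1 t1 s2 t2 0 m1 m2; rewrite (ip0r he) subr0.
  have Q0 : dual_cone (pQ P) 0 by move=> v _; rewrite (ip0l he).
  by move=> /(_ Q0); lra.
apply: contrapT => /(dual_cone_separation (Q_polyhedral hP)) [y yQ yneg].
have [|s1 [t1 [m1 _]]] := hmin x0 (fine (ph P x0) - 1).
  by rewrite [in X in (_ < X)%E](edom_fineK hN dx0) lte_fin; lra.
have [|s2 [t2 [m2 _]]] := tmin X0 (fine (ptheta P X0) - 1).
  by rewrite [in X in (_ < X)%E](edom_fineK tN dX0) lte_fin; lra.
set q := pA P X - pb P in yneg.
pose K := b - (mxdot s1 (pF P X) - t1 + Xdot (pC P) X + (Xdot s2 X - t2)).
(* The multiple t makes the separating term exceed the fixed remainder K. *)
pose t := (`|K| + 1) / - mxdot q y.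
have D0 : 0 < - mxdot q y by rewrite oppr_gt0.
have t0 : 0 <= t by rewrite divr_ge0 ?addr_ge0 // ltW.
have tyQ : dual_cone (pQ P) (t *: y).
  by move=> v Qv; rewrite (ipZl he) mulr_ge0 // yQ.
have := bound _ _ _ _ _ m1 m2 tyQ; rewrite -/q (ipZr he).
have -> : t * mxdot q y = - (`|K| + 1).
  by rewrite /t invrN mulrN mulNr divfK // lt_eqF.
have := ler_norm K; rewrite /K; lra.
Qed.

Lemma Psi_proper : exists z a, (Psi P (dpack z) <= a%:E)%E.
Proof.
have hN := h_gtNy hP; have tN := theta_gtNy hP.
have [x0 dx0] := h_dom0 hP; have [X0 dX0] := theta_dom0 hP.
have [|s1 [t1 [m1 _]]] := affine_minorant hd hN (h_dom0 hP) (h_convex hP)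
  (mx_enorm_lsc (h_closed hP)) (x0 := x0) (alpha := fine (ph P x0) - 1).
  by rewrite [in X in (_ < X)%E](edom_fineK hN dx0) lte_fin; lra.
have [|s2 [t2 [m2 _]]] := affine_minorant hX tN (theta_dom0 hP) (theta_convex hP)
  (Xdot_enorm_lsc (theta_closed hP)) (x0 := X0) (alpha := fine (ptheta P X0) - 1).
  by rewrite [in X in (_ < X)%E](edom_fineK tN dX0) lte_fin; lra.
have Q0 : dual_cone (pQ P) 0 by move=> v _; rewrite (ip0l he).
by exists (0, - s1, - s2), (t1 + t2 - mxdot (pb P) 0); apply: affine_minorant_Psi.
Qed.

End DualFunction.

(** * The inexact proximal point method *)

Section ProximalPoint.
Variables (R : realType) (E : lmodType R) (ip : E -> E -> R).
Hypothesis hE : euclidean ip.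
Local Notation "<< x , y >>" := (ip x y).
Local Notation nrm := (enorm ip).
Local Notation ipC := (ipC hE).
Local Notation ipE := (ipE hE).

(** A closed convex function phi is represented by the relation phi(x) <= b, so
that it may take the value +oo. *)
Variable phi_le : E -> R -> Prop.

(** The point p minimises phi + |. - x|^2 / (2 c) and v = phi(p), expressed by
the first order condition: (x - p) / c is a subgradient of phi at p. *)
Definition prox_step (c : R) (x p : E) (v : R) : Prop :=
  phi_le p v /\
  forall x' b, phi_le x' b -> v + c^-1 * << p - x', p - x >> <= b.

Variable alpha : R.
Hypothesis phi_min : forall x b, phi_le x b -> alpha <= b.
Hypothesis phi_closed : forall (F : set_system nat) (x : nat -> E) (b : nat -> R)
  x0 (b0 : R), ProperFilter F -> (fun k => nrm (x k - x0)) @ F --> (0 : R) ->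
  b @ F --> b0 -> (forall k, phi_le (x k) (b k)) -> phi_le x0 b0.

(** The subgradient inequality at a minimiser xs gives <p - xs, p - x> <= 0. *)
Lemma prox_pythagoras c x p v xs : 0 < c -> prox_step c x p v ->
  phi_le xs alpha ->
  << p - xs, p - xs >> + << p - x, p - x >> <= << x - xs, x - xs >>.
Proof.
move=> c0 [pv hp] hxs; have := hp _ _ hxs; have := phi_min pv.
have : << p - xs, p - x >> <= 0 -> << p - xs, p - xs >> + << p - x, p - x >>
    <= << x - xs, x - xs >>.
  have -> : x - xs = (p - xs) - (p - x) by rewrite opprB [RHS]addrC subrKA.
  by move: (p - xs) (p - x) => u w; rewrite !ipE (ipC w u); lra.
move=> h h1 h2; apply: h; rewrite -(pmulr_rle0 _ (x := c^-1)) ?invr_gt0 //; lra.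
Qed.

Lemma prox_nonexpansive c x p v xs : 0 < c -> prox_step c x p v ->
  phi_le xs alpha -> nrm (p - xs) <= nrm (x - xs).
Proof.
move=> c0 hp hxs; rewrite ler_wsqrtr //.
have := prox_pythagoras c0 hp hxs; have := ip_ge0 hE (p - x); lra.
Qed.

Lemma prox_displacement c x p v xs : 0 < c -> prox_step c x p v ->
  phi_le xs alpha -> nrm (p - x) <= nrm (x - xs).
Proof.
move=> c0 hp hxs; rewrite ler_wsqrtr //.
have := prox_pythagoras c0 hp hxs; have := ip_ge0 hE (p - xs); lra.
Qed.

End ProximalPoint.

(** Subtracting the partial sums of eps makes the sequence nonincreasing. *)
Lemma quasi_fejer_cvg (R : realType) (a eps : nat -> R) :
  (forall k, 0 <= a k) -> (forall k, 0 <= eps k) -> cvgn (series eps) ->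
  (forall k, a k.+1 <= a k + eps k) ->
  (exists M, forall k, a k <= M) /\ cvgn a.
Proof.
move=> a0 e0 ecv ha.
have S1 k : series eps k.+1 = series eps k + eps k.
  by rewrite /series /= big_nat_recr.
have Sle k : series eps k <= limn (series eps).
  apply: nondecreasing_cvgn_le => //.
  by apply/nondecreasing_seqP => j; rewrite S1 lerDl.
pose b k := a k - series eps k.
have bS k : b k.+1 <= b k by rewrite /b S1; have := ha k; lra.
have bdec : {homo b : i j / (i <= j)%N >-> j <= i} by apply/nonincreasing_seqP.
have bcv : cvgn b.
  apply: nonincreasing_is_cvgn => //.
  exists (- limn (series eps)) => _ [k _ <-]; rewrite /b.
  by have := a0 k; have := Sle k; lra.
have aE : a = b \+ series eps by apply/funext => k; rewrite /b /= subrK.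
split; last by rewrite aE; apply: is_cvgD.
exists (b 0%N + limn (series eps)) => k; rewrite aE /=.
by apply: lerD => //; apply: bdec.
Qed.

Section InexactProximalPoint.
Variables (R : realType) (E : lmodType R) (ip : E -> E -> R).
Hypothesis hE : euclidean ip.
Local Notation "<< x , y >>" := (ip x y).
Local Notation nrm := (enorm ip).

(** The distances to any minimiser are quasi-monotone, hence convergent, and the
exact proximal points have the same limit distance, so the displacements
p k - x k vanish. A cluster point of x is a minimiser because the values v k are
at most alpha plus a multiple of the displacement; the distances to this cluster
point converge, and their limit is 0 along a finer filter. *)
Theorem inexact_proximal_point (phi_le : E -> R -> Prop) (alpha : R)
    (x p : nat -> E) (v c eps : nat -> R) (xs : E) :
  (forall x b, phi_le x b -> alpha <= b) ->
  (forall x b b', b <= b' -> phi_le x b -> phi_le x b') ->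
  (forall (F : set_system nat) (x : nat -> E) (b : nat -> R) x0 (b0 : R),
     ProperFilter F -> (fun k => nrm (x k - x0)) @ F --> (0 : R) ->
     b @ F --> b0 -> (forall k, phi_le (x k) (b k)) -> phi_le x0 b0) ->
  phi_le xs alpha ->
  0 < c 0%N -> (forall k, c 0%N <= c k) ->
  (forall k, prox_step ip phi_le (c k) (x k) (p k) (v k)) ->
  (forall k, 0 <= eps k) -> cvgn (series eps) ->
  (forall k, nrm (x k.+1 - p k) <= eps k) ->
  [/\ exists M, forall k, nrm (x k) <= M,
      (fun k => nrm (p k - x k)) @ \oo --> (0 : R) &
      exists2 xinf, phi_le xinf alpha &
        (fun k => nrm (x k - xinf)) @ \oo --> (0 : R)].
Proof.
move=> phi_min phi_up phi_closed hxs c00 c0k hprox e0 ecv hstep.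
have cpos k : 0 < c k by apply: lt_le_trans c00 (c0k k).
have fejer y : phi_le y alpha -> (exists M, forall k, nrm (x k - y) <= M) /\
    cvgn (fun k => nrm (x k - y)).
  move=> hy; apply: (quasi_fejer_cvg (eps := eps)) => // [k|k].
    exact: enorm_ge0.
  have := enorm_triangle hE (p k) (x k.+1) y.
  have := prox_nonexpansive hE phi_min (cpos k) (hprox k) hy.
  by have := hstep k; lra.
have [[M hM] xcv] := fejer xs hxs.
have ecv0 : eps @ \oo --> (0 : R) by apply: cvg_series_cvg_0.
set l := limn (fun k => nrm (x k - xs)).
have xl : (fun k => nrm (x k - xs)) @ \oo --> l by [].
have pl : (fun k => nrm (p k - xs)) @ \oo --> l.
  have low : (fun k => nrm (x k.+1 - xs) - eps k) @ \oo --> l - 0.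
    apply: cvgB => //; have := xl; rewrite -(cvg_shiftS (fun k => nrm (x k - xs))).
    exact.
  rewrite subr0 in low; apply: (squeeze_cvgr _ low xl); apply: filterE => k.
  apply/andP; split; last exact: (prox_nonexpansive hE phi_min (cpos k) (hprox k) hxs).
  have := enorm_triangle hE (p k) (x k.+1) xs; have := hstep k; lra.
have px : (fun k => nrm (p k - x k)) @ \oo --> (0 : R).
  have up : (fun k => Num.sqrt (nrm (x k - xs) ^+ 2 - nrm (p k - xs) ^+ 2)) @ \oo
      --> (0 : R).
    rewrite -sqrtr0; apply: (continuous_cvg _ (@sqrt_continuous _ 0)).
    rewrite -[X in _ --> X](subrr (l ^+ 2)); apply: cvgB.
      exact: (cvgM xl xl).
    exact: (cvgM pl pl).
  apply: (squeeze_cvgr _ (cvg_cst (0 : R)) up); apply: filterE => k.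
  rewrite enorm_ge0 /= ler_wsqrtr // !(sqr_enorm hE).
  have := prox_pythagoras hE phi_min (cpos k) (hprox k) hxs; lra.
have bnd : exists M, forall k, nrm (x k) <= M.
  exists (M + nrm xs) => k; rewrite -{1}(subrK xs (x k)).
  by apply: le_trans (ler_enormD hE _ _) _; rewrite lerD2r.
split => //.
have [N hN] := bnd.
have [U [UU sU]] := @ultraFilterLemma nat \oo _.
have [xinf hxinf] := enorm_compact hE UU hN.
have hinf : phi_le xinf alpha.
  have pU : (fun k => nrm (p k - xinf)) @ U --> (0 : R).
    have up : (fun k => nrm (p k - x k) + nrm (x k - xinf)) @ U --> (0 + 0 : R).
      by apply: cvgD => //; apply: (cvg_finer sU px).
    rewrite addr0 in up.
    apply: (squeeze_cvgr _ (cvg_cst (0 : R)) up); apply: filterE => k.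
    by rewrite enorm_ge0 /= enorm_triangle.
  have vl : (fun k => alpha + (c 0%N)^-1 * (M * nrm (p k - x k))) @ U -->
      alpha + (c 0%N)^-1 * (M * 0).
    apply: cvgD; first exact: cvg_cst.
    apply: cvgM; first exact: cvg_cst.
    by apply: cvgM; [exact: cvg_cst|exact: (cvg_finer sU px)].
  rewrite !mulr0 addr0 in vl.
  apply: (phi_closed _ _ _ _ _ _ pU (vl)) => k.
  have [pv /(_ _ _ hxs) h] := hprox k; apply: phi_up pv.
  suff : - ((c 0%N)^-1 * (M * nrm (p k - x k))) <=
      (c k)^-1 * << p k - xs, p k - x k >> by lra.
  have ck : (c k)^-1 <= (c 0%N)^-1 by rewrite lef_pV2 ?posrE.
  have ck0 : 0 <= (c k)^-1 by rewrite invr_ge0 ltW.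
  have pM : nrm (p k - xs) <= M.
    by apply: le_trans (hM k); apply: (prox_nonexpansive hE phi_min (cpos k) (hprox k) hxs).
  have := cauchy_schwarz hE (p k - xs) (p k - x k).
  rewrite ler_norml => /andP[cs _].
  have d0 := enorm_ge0 ip (p k - x k); have d1 := enorm_ge0 ip (p k - xs).
  have h1 : nrm (p k - xs) * nrm (p k - x k) <= M * nrm (p k - x k) by nra.
  have h2 : (c k)^-1 * (M * nrm (p k - x k)) <= (c 0%N)^-1 * (M * nrm (p k - x k)).
    by rewrite ler_wpM2r //; nra.
  have h3 : (c k)^-1 * - (M * nrm (p k - x k)) <=
      (c k)^-1 * << p k - xs, p k - x k >> by rewrite ler_wpM2l //; lra.
  lra.
exists xinf => //.
have [_ xicv] := fejer _ hinf.
set li := limn (fun k => nrm (x k - xinf)) in xicv.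
have li0 : li = 0.
  exact: (cvg_unique (@Rhausdorff R) (cvg_finer sU xicv) hxinf).
by rewrite -li0.
Qed.

End InexactProximalPoint.

(** * One step of the method of multipliers is an inexact proximal step *)

Section AugmentedLagrangianStep.
Variables (R : realType) (n m d e : nat) (V : {vspace 'M[R]_(n, m)}).
Hypothesis hV : matrix_space V.
Variable P : problem d e V.
Hypothesis hP : standing_assumptions P.
Hypothesis hOmegaP : OmegaP P !=set0.
Local Notation XX := (subvs_of V).
Let hX := Xdot_euclidean hV.
Let hZ := Zdot_euclidean d e hV.
Local Notation Xdot := (@Xdot R n m V).
Local Notation Zdot := (@Zdot R n m d e V).
Local Notation res z := (residual P (dpack z)).

Lemma primal_le_up (X : XX) (b b' : R) : b <= b' -> primal_le P X b -> primal_le P X b'.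
Proof. by move=> bb h z a hz; apply: le_trans (h z a hz) bb. Qed.

Lemma primal_le_closed (F : set_system nat) (X : nat -> XX) (b : nat -> R)
    X0 (b0 : R) : ProperFilter F ->
  (fun k => enorm Xdot (X k - X0)) @ F --> (0 : R) -> b @ F --> b0 ->
  (forall k, primal_le P (X k) (b k)) -> primal_le P X0 b0.
Proof.
move=> FF XX0 bb h z a hz.
have l : (fun k => - a - Xdot (res z) (X k)) @ F --> - a - Xdot (res z) X0.
  apply: cvgB; first exact: cvg_cst.
  exact: (cvg_ipr hX FF XX0).
rewrite (ipC hX); apply: (ler_cvg_to l bb); apply: filterE => k.
by rewrite (ipC hX); apply: h.
Qed.

Lemma OmegaP_primal_le : exists alpha : R,
  [/\ forall X, OmegaP P X <-> primal_le P X alpha,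
      forall X b, primal_le P X b -> alpha <= b &
      forall X, OmegaP P X -> Phi P X = alpha%:E].
Proof.
have [Xs [fXs dXs hXs]] := hOmegaP.
have PN X : (-oo < Phi P X)%E.
  rewrite /Phi; have := h_gtNy hP (pF P X); have := theta_gtNy hP X.
  by case: (ptheta P X) => [?| |] //; case: (ph P (pF P X)) => [?| |] //;
    rewrite ?ltNyr ?ltNyy.
have PXs : Phi P Xs = (fine (Phi P Xs))%:E.
  by rewrite fineK // fin_numE gt_eqF ?PN // lt_eqF.
exists (fine (Phi P Xs)); split => [X|X b|X].
- rewrite (primal_leP hV hP) -PXs; split=> [[fX _ h]|[fX le]].
    by split => //; exact: h.
  by split => // [|X' /hXs]; [exact: le_lt_trans le dXs|exact: le_trans].
- by move=> /(primal_leP hV hP) [/hXs]; rewrite {1}PXs; move=> h /(le_trans h).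
- by move=> [fX _ h]; rewrite -PXs; apply/le_anti; rewrite h // hXs.
Qed.

Lemma Psi_finP (Z : dualvar d e V) : (Psi P Z < +oo)%E ->
  Psi P Z = (fine (Psi P Z))%:E.
Proof.
move=> h; rewrite fineK // fin_numE gt_eqF ?lt_eqF //.
by rewrite -(dunpackK Z); apply: (Psi_gtNy hV hP).
Qed.

Lemma aug_lagrangianE c X Z a : Psi P Z = a%:E ->
  aug_lagrangian P c Z X = (quad Xdot X c (residual P Z) a)%:E.
Proof.
by move=> h; rewrite /aug_lagrangian /lagrangian h -!EFinD (sqr_enorm hX).
Qed.

Lemma residual_mix z z' (t : R) :
  res (t *: z + (1 - t) *: z') = t *: res z + (1 - t) *: res z'.
Proof.
apply/eqP; rewrite -subr_eq0; apply/eqP/(ip_inj hX) => Y.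
rewrite (ipDr hX) (ipNr hX) [X in _ - X](ipDr hX) !(ipZr hX).
by rewrite !(Xdot_residual hV hP) !(ipE hZ); ring.
Qed.

(** The epigraph, up to attainment, of the perturbation function of the dual
problem: the infimum of Psi under a prescribed residual. *)
Definition dual_rel (u : XX) (a : R) : Prop :=
  exists2 z, res z = u & (Psi P (dpack z) <= a%:E)%E.

Lemma dual_rel_convex : convex_rel dual_rel.
Proof.
move=> u u' a a' t t01 [z <- hz] [z' <- hz'].
exists (t *: z + (1 - t) *: z'); first exact: residual_mix.
exact: (Psi_convex hV hP).
Qed.

(** The infimum is bounded below by weak duality with a primal solution, the
linear term being absorbed by the quadratic one. *)
Lemma inf_aug_lagrangian c (X : XX) : 0 < c -> exists mu : R,
  [/\ ereal_inf [set aug_lagrangian P c Z X | Z in [set: dualvar d e V]] = mu%:E,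
      forall u a, dual_rel u a -> mu <= quad Xdot X c u a &
      forall del : R, 0 < del ->
        exists u a, dual_rel u a /\ quad Xdot X c u a <= mu + del].
Proof.
move=> c0; have [alpha [OP _ _]] := OmegaP_primal_le.
have [Xs /OP hXs] := hOmegaP.
set S := [set _ | _ in _].
pose low := - alpha - c^-1 / 2 * Xdot (X - Xs) (X - Xs).
have hlow u a : dual_rel u a -> low <= quad Xdot X c u a.
  move=> [z <- hz]; have := hXs _ _ hz.
  have : Xdot X (res z) = Xdot (X - Xs) (res z) + Xdot Xs (res z).
    by rewrite -(ipDl hX) subrK.
  rewrite /quad /low; move: (X - Xs) (res z) => D r -> h.
  have := ip_ge0 hX (D + c *: r).
  have -> : Xdot (D + c *: r) (D + c *: r) =
      2 * c * (c^-1 / 2 * Xdot D D + Xdot D r + c / 2 * Xdot r r).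
    by rewrite !(ipE hX) (ipC hX r D); field; rewrite gt_eqF.
  rewrite pmulr_rge0 ?mulr_gt0 //; lra.
have [z0 [a0 hz0]] := Psi_proper hV hP.
have mem Z a : Psi P Z = a%:E -> dual_rel (residual P Z) a.
  by move=> h; exists (dunpack Z); rewrite dunpackK // h.
have lowS : (low%:E <= ereal_inf S)%E.
  apply: le_ereal_inf_tmp => _ [Z _ <-].
  have [/Psi_finP h|] := ltP (Psi P Z) +oo%E.
    by rewrite (aug_lagrangianE _ _ h) lee_fin; exact: hlow (mem _ _ h).
  by rewrite leye_eq => /eqP h; rewrite /aug_lagrangian /lagrangian h leey.
have hinf u a : dual_rel u a -> (ereal_inf S <= (quad Xdot X c u a)%:E)%E.
  move=> [z <- hz].
  have := Psi_finP (le_lt_trans hz (ltry _)) => hf.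
  apply: (@le_trans _ _ (aug_lagrangian P c (dpack z) X)).
    by apply: ereal_inf_lbound; exists (dpack z).
  rewrite (aug_lagrangianE _ _ hf) lee_fin /quad.
  by move: hz; rewrite hf lee_fin => hz; rewrite !lerD2r.
have fin : ereal_inf S = (fine (ereal_inf S))%:E.
  rewrite fineK // fin_numE gt_eqF ?(lt_le_trans _ lowS) ?ltNyr // lt_eqF //.
  by apply: le_lt_trans (ltry (quad Xdot X c (res z0) a0)); apply: hinf; exists z0.
exists (fine (ereal_inf S)); split => // [u a /hinf|del del0].
  by rewrite fin lee_fin.
have [|_ [Z _ <-]] := @lb_ereal_inf_adherent _ S del del0.
  by rewrite fin.
rewrite fin -EFinD; have [/Psi_finP h|] := ltP (Psi P Z) +oo%E.
  rewrite (aug_lagrangianE _ _ h) lte_fin => /ltW lt.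
  by exists (residual P Z), (fine (Psi P Z)); split => //; exact: mem.
by rewrite leye_eq => /eqP h; rewrite /aug_lagrangian /lagrangian h.
Qed.

(** If us is the limit of minimising residuals, the strong convexity inequality
at us says that the Lagrangian at X + c us is bounded below by
mu + (c/2) |us|^2, that is, phi(X + c us) <= v; the minimising residuals
themselves provide the affine minorants of phi that give the subgradient
inequality. *)
Lemma aug_lagrangian_prox c (X : XX) (mu : R) : 0 < c ->
  (forall u a, dual_rel u a -> mu <= quad Xdot X c u a) ->
  (forall del : R, 0 < del ->
     exists u a, dual_rel u a /\ quad Xdot X c u a <= mu + del) ->
  exists Q v, prox_step Xdot (primal_le P) c X Q v /\
    forall u a sig, dual_rel u a -> quad Xdot X c u a <= mu + sig ->
      Xdot (X + c *: u - Q) (X + c *: u - Q) <= 2 * c * sig.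
Proof.
move=> c0 hmu happ.
have [us [[u [hu ul]] strong]] := quad_minimizer hX c0 dual_rel_convex hmu happ.
exists (X + c *: us), (- mu - c / 2 * Xdot us us); split; first split.
- move=> z a hz; have := strong (res z) a (ex_intro2 _ _ z erefl hz).
  by move: (res z) => r; rewrite /quad !(ipE hX) (ipC hX us r); lra.
- move=> X' b hb; rewrite [X in c^-1 * X](_ : _ = c * Xdot (X + c *: us - X') us); last first.
    by rewrite [X + _ - X]addrAC subrr add0r (ipZr hX).
  rewrite mulKf ?gt_eqF //.
  have l1 : (fun k => - (mu + k.+1%:R^-1) + Xdot (X - X') (u k) +
      c / 2 * enorm Xdot (u k - 0) ^+ 2) @ \oo -->
      - (mu + 0) + Xdot (X - X') us + c / 2 * enorm Xdot (us - 0) ^+ 2.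
    apply: cvgD; first apply: cvgD.
    - by apply: cvgN; apply: cvgD; [exact: cvg_cst|exact: cvg_harmonic].
    - exact: (cvg_ipr hX _ ul _).
    - apply: cvgM; first exact: cvg_cst.
      by apply: cvgM; exact: (cvg_enormB hX _ ul _).
  have : - (mu + 0) + Xdot (X - X') us + c / 2 * enorm Xdot (us - 0) ^+ 2 <= b.
    apply: (cvgr_to_le l1); apply: filterE => k.
    have [a [[z zu hz] hq]] := hu k.
    have := hb _ _ hz; move: hq; rewrite zu subr0 (sqr_enorm hX) /quad.
    by move: (k.+1%:R^-1) => eps; rewrite (ipDl hX) (ipNl hX); lra.
  rewrite subr0 (sqr_enorm hX) !(ipDl hX) !(ipNl hX) (ipZl hX); lra.
- move=> w a sig hw hq; have := strong _ _ hw.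
  have -> : X + c *: w - (X + c *: us) = c *: (w - us).
    by rewrite opprD addrACA subrr add0r scalerBr.
  rewrite (ipZl hX) (ipZr hX) => h.
  have : c / 2 * Xdot (w - us) (w - us) <= sig by lra.
  nra.
Qed.

Lemma subopt_finP c X Z mu (sig : R) :
  ereal_inf [set aug_lagrangian P c Z X | Z in [set: dualvar d e V]] = mu%:E ->
  (subopt P c X Z <= sig%:E)%E ->
  exists a, [/\ Psi P Z = a%:E, dual_rel (residual P Z) a,
    quad Xdot X c (residual P Z) a <= mu + sig &
    subopt P c X Z = (quad Xdot X c (residual P Z) a - mu)%:E].
Proof.
move=> hmu; have [/Psi_finP h|] := ltP (Psi P Z) +oo%E; last first.
  rewrite leye_eq => /eqP h; rewrite /subopt hmu /aug_lagrangian /lagrangian h.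
  by [].
have sE : subopt P c X Z =
    (quad Xdot X c (residual P Z) (fine (Psi P Z)) - mu)%:E.
  by rewrite /subopt hmu (aug_lagrangianE _ _ h) -EFinB.
rewrite sE lee_fin => hs; exists (fine (Psi P Z)); split => //; last by lra.
by exists (dunpack Z); rewrite dunpackK // -h.
Qed.

End AugmentedLagrangianStep.

(** * Boundedness and accumulation points of the dual sequence *)

Lemma cvg_subsequence (R : realType) (u : nat -> R) (l : R) (f : nat -> nat) :
  (forall N, (N <= f N)%N) -> u @ \oo --> l -> (u \o f) @ \oo --> l.
Proof.
move=> hf ul A /ul [N _ hN]; exists N => // k /= Nk.
by apply: hN; exact: leq_trans (hf k).
Qed.

Section DualConvergence.
Variables (R : realType) (n m d e : nat) (V : {vspace 'M[R]_(n, m)}).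
Hypothesis hV : matrix_space V.
Variable P : problem d e V.
Hypothesis hP : standing_assumptions P.
Local Notation XX := (subvs_of V).
Let hX := Xdot_euclidean hV.
Let hZ := Zdot_euclidean d e hV.
Local Notation Xdot := (@Xdot R n m V).
Local Notation Zdot := (@Zdot R n m d e V).
Local Notation res z := (residual P (dpack z)).

Lemma dual_distE Z Z' : dual_dist Z Z' = enorm Zdot (dunpack Z - dunpack Z').
Proof.
by rewrite /dual_dist /mxnorm /Xnorm /mxnorm !sqr_sqrtr
  ?(ip_ge0 (mxdot_euclidean R _ _)).
Qed.

Lemma dual_normE Z : dual_norm Z = enorm Zdot (dunpack Z).
Proof. by rewrite /dual_norm dual_distE subr0. Qed.

Lemma residual_eq0 Z : dual_feasible P Z <-> residual P Z = 0.
Proof.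
rewrite /dual_feasible /residual /=; split=> [->|/eqP]; first by rewrite subrr.
by rewrite subr_eq0 => /eqP.
Qed.

Variable Z0 : dualvar d e V.
Hypothesis OZ0 : OmegaD P Z0.
Let ps := fine (Psi P Z0).

Lemma OmegaD_val : Psi P Z0 = ps%:E.
Proof. by have [_ h _] := OZ0; apply: (Psi_finP hV hP). Qed.

Lemma Psi_star_val : Psi_star P = ps%:E.
Proof.
have [f0 _ opt] := OZ0; rewrite -OmegaD_val; apply/le_anti/andP; split.
  by apply: ereal_inf_lbound; exists Z0.
by apply: le_ereal_inf_tmp => _ [Z fZ <-]; exact: opt.
Qed.

Lemma dual_limit (F : set_system nat) (z : nat -> 'cV[R]_e * 'cV[R]_d * XX)
    (del : nat -> R) zb : ProperFilter F ->
  (fun k => enorm Zdot (z k - zb)) @ F --> (0 : R) ->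
  del @ F --> (0 : R) -> (fun k => enorm Xdot (res (z k))) @ F --> (0 : R) ->
  (forall k, (Psi P (dpack (z k)) <= (ps + del k)%:E)%E) ->
  OmegaD P (dpack zb).
Proof.
move=> FF zzb del0 r0 hPsi.
have le : (Psi P (dpack zb) <= ps%:E)%E.
  apply: (Psi_closed hV hP FF zzb (a := fun k => ps + del k)) => //.
  by rewrite -[X in _ --> X]addr0; apply: cvgD => //; exact: cvg_cst.
have feas : dual_feasible P (dpack zb).
  apply/residual_eq0/(ip_inj hX) => Y.
  have l1 : (fun k => Xdot Y (res (z k))) @ F --> Xdot Y (res zb).
    under eq_fun do rewrite (Xdot_residual hV hP).
    rewrite (Xdot_residual hV hP); apply: cvgB; last exact: cvg_cst.
    exact: (cvg_ipr hZ FF zzb).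
  have l2 : (fun k => Xdot Y (res (z k))) @ F --> (0 : R).
    rewrite -[X in _ --> X](ip0r hX Y); apply: (cvg_ipr hX FF).
    by under eq_fun do rewrite subr0.
  exact: (cvg_unique (@Rhausdorff R) l1 l2).
split => // [|Z' fZ']; first exact: le_lt_trans le (ltry _).
apply: le_trans le _; rewrite -OmegaD_val.
by have [_ _] := OZ0; apply.
Qed.

(** If infinitely many z k were far from the dual solution z0, the points w N on
the segments from z0 to them, at distance exactly rho from z0, would still be
nearly feasible and nearly optimal by convexity. A cluster point of w would be a
dual solution at distance rho from z0, beyond the bound on the solution set. *)
Lemma dual_sequence_bounded (z : nat -> 'cV[R]_e * 'cV[R]_d * XX)
    (del : nat -> R) :
  dual_bounded (OmegaD P) ->
  del @ \oo --> (0 : R) -> (fun k => enorm Xdot (res (z k))) @ \oo --> (0 : R) ->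
  (forall k, (Psi P (dpack (z k)) <= (ps + del k)%:E)%E) ->
  exists M, forall k, enorm Zdot (z k) <= M.
Proof.
move=> [M hM] del0 r0 hPsi.
pose z0 := dunpack Z0; pose rho := `|M| + enorm Zdot z0 + 1.
have nz0 := enorm_ge0 Zdot z0.
have rho0 : 0 < rho by rewrite ltr_wpDl // addr_ge0.
have [N hN] : exists N, forall k, (N <= k)%N -> enorm Zdot (z k - z0) <= rho.
  apply: contrapT => nope.
  have /choice [f hf] : forall N, exists k,
      (N <= k)%N /\ rho < enorm Zdot (z k - z0).
    move=> N; apply: contrapT => nk; apply: nope; exists N => k Nk.
    by rewrite leNgt; apply/negP => h; apply: nk; exists k.
  have fN N : (N <= f N)%N by have [] := hf N.
  pose t N := rho / enorm Zdot (z (f N) - z0).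
  have den N : 0 < enorm Zdot (z (f N) - z0).
    by have [_] := hf N; exact: lt_trans.
  have t01 N : 0 <= t N <= 1.
    apply/andP; split; first by rewrite divr_ge0 // ltW.
    by rewrite ler_pdivrMr // mul1r; apply: ltW; have [] := hf N.
  pose w N := t N *: z (f N) + (1 - t N) *: z0.
  have wz0 N : w N - z0 = t N *: (z (f N) - z0).
    by rewrite /w scalerBl scale1r scalerBr addrA addrAC addrK.
  have nw N : enorm Zdot (w N - z0) = rho.
    rewrite wz0 (enormZ hZ) ger0_norm; last by have /andP[] := t01 N.
    by rewrite /t divfK // gt_eqF.
  have wbnd N : enorm Zdot (w N) <= rho + enorm Zdot z0.
    rewrite -{1}(subrK z0 (w N)); apply: le_trans (ler_enormD hZ _ _) _.
    by rewrite nw.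
  have [U [UU sU]] := @ultraFilterLemma nat \oo _.
  have [wb hwb] := enorm_compact hZ UU wbnd.
  have Owb : OmegaD P (dpack wb).
    apply: (dual_limit (F := U) (z := w) (del := fun N => `|del (f N)|)) => //.
    - apply: (cvg_finer sU).
      have h := cvg_norm (cvg_subsequence fN del0); rewrite normr0 in h.
      exact: h.
    - apply: (cvg_finer sU).
      apply: (squeeze_cvgr _ (cvg_cst (0 : R)) (cvg_subsequence fN r0)).
      apply: filterE => N; rewrite enorm_ge0 /= /w (residual_mix hV hP) dunpackK.
      have [/residual_eq0 -> _ _] := OZ0.
      have /andP[t0 t1] := t01 N.
      by rewrite scaler0 addr0 (enormZ hX) ger0_norm // ler_piMl // enorm_ge0.
    - move=> N; have := Psi_convex hV hP (t01 N) (hPsi (f N)) (a' := ps).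
      move=> /(_ z0); rewrite dunpackK OmegaD_val lexx => /(_ isT) /le_trans; apply.
      have /andP[t0 t1] := t01 N; rewrite lee_fin.
      have := ler_norm (del (f N)); have := normr_ge0 (del (f N)); nra.
  have rw : enorm Zdot (wb - z0) = rho.
    have l1 := cvg_enormB hZ (@ultra_proper _ U UU) hwb z0.
    have l2 : (fun N => enorm Zdot (w N - z0)) @ U --> rho.
      by under eq_fun do rewrite nw; exact: cvg_cst.
    exact: (cvg_unique (@Rhausdorff R) l1 l2).
  have := hM _ Owb; rewrite dual_normE dpackK.
  have := ler_enormD hZ wb (- z0); rewrite rw (enormN hZ).
  by have := ler_norm M; rewrite /rho; lra.
exists (rho + enorm Zdot z0 + \sum_(i < N) enorm Zdot (z i)) => k.
have s0 : 0 <= \sum_(i < N) enorm Zdot (z i).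
  by apply: sumr_ge0 => i _; exact: enorm_ge0.
have [Nk|kN] := leqP N k.
  apply: (@le_trans _ _ (rho + enorm Zdot z0)); last by rewrite lerDl.
  rewrite -{1}(subrK z0 (z k)); apply: le_trans (ler_enormD hZ _ _) _.
  by rewrite lerD2r hN.
apply: (@le_trans _ _ (\sum_(i < N) enorm Zdot (z i))); last first.
  by rewrite lerDr addr_ge0 // ltW.
rewrite (bigD1 (Ordinal kN)) //= lerDl.
by apply: sumr_ge0 => i _; exact: enorm_ge0.
Qed.

End DualConvergence.

(** * Linear rate under quadratic growth *)

Section Distance.
Variables (R : realType) (n m : nat) (V : {vspace 'M[R]_(n, m)}).
Hypothesis hV : matrix_space V.
Let hX := Xdot_euclidean hV.
Local Notation XX := (subvs_of V).
Local Notation Xdot := (@Xdot R n m V).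
Local Notation Xnorm := (@Xnorm R n m V).
Variable S : set XX.

Lemma sqr_Xnorm X : Xnorm X ^+ 2 = Xdot X X.
Proof. exact: (sqr_enorm hX). Qed.

Lemma dist_le X Y : S Y -> dist X S <= Xnorm (X - Y).
Proof.
move=> SY; apply: ge_inf; last by exists Y.
by exists 0 => _ [Y' _ <-]; exact: (enorm_ge0 Xdot).
Qed.

Hypothesis S0 : S !=set0.

Lemma le_dist X b : (forall Y, S Y -> b <= Xnorm (X - Y)) -> b <= dist X S.
Proof.
move=> h; apply: lb_le_inf; last by move=> _ [Y SY <-]; exact: h.
by have [Y SY] := S0; exists (Xnorm (X - Y)), Y.
Qed.

Lemma dist_ge0 X : 0 <= dist X S.
Proof. by apply: le_dist => Y _; exact: (enorm_ge0 Xdot). Qed.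

Lemma dist_triangle X Y : dist X S <= Xnorm (X - Y) + dist Y S.
Proof.
rewrite -lerBlDl; apply: le_dist => W SW; rewrite lerBlDl.
exact: le_trans (dist_le _ SW) (enorm_triangle hX _ _ _).
Qed.

Section Rate.
Variables (phi_le : XX -> R -> Prop) (alpha : R).
Hypothesis phi_min : forall X b, phi_le X b -> alpha <= b.
Hypothesis SE : forall X, S X <-> phi_le X alpha.
Variables (c : R) (X Q : XX) (v : R).
Hypothesis c0 : 0 < c.
Hypothesis prox : prox_step Xdot phi_le c X Q v.

Lemma prox_displacement_dist : Xnorm (Q - X) <= dist X S.
Proof.
by apply: le_dist => Y /SE hY; exact: (prox_displacement hX phi_min c0 prox hY).
Qed.

(** Growth at Q and the subgradient inequality against a solution Y give
kappa dist(Q)^2 <= <Q - Y, X - Q> / c; taking the infimum over Y,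
c kappa dist(Q) <= |Q - X|. The claim follows by inserting this bound into
|Q - Y|^2 + |Q - X|^2 <= |X - Y|^2. *)
Lemma prox_contraction kappa : 0 < kappa ->
  alpha + kappa * dist Q S ^+ 2 <= v -> dist Q S <= mu_rate kappa c * dist X S.
Proof.
move=> k0 growth.
have D0 := dist_ge0 Q; set D := dist Q S in growth D0 *.
have far : c * kappa * D <= Xnorm (Q - X).
  have [->|Dn0] := eqVneq D 0; first by rewrite mulr0; exact: (enorm_ge0 Xdot).
  have Dp : 0 < D by rewrite lt_def Dn0.
  have B0 : 0 <= Xnorm (Q - X) by exact: (enorm_ge0 Xdot).
  have key Y : S Y -> c * kappa * D ^+ 2 <= Xnorm (Q - Y) * Xnorm (Q - X).
    move=> /SE hY; have [_ /(_ _ _ hY)] := prox.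
    have := cauchy_schwarz hX (Q - Y) (Q - X); rewrite ler_norml => /andP[+ _].
    rewrite -[enorm _ (Q - Y)]/(Xnorm (Q - Y)) -[enorm _ (Q - X)]/(Xnorm (Q - X)).
    move=> cs h.
    have : kappa * D ^+ 2 <= c^-1 * (Xnorm (Q - Y) * Xnorm (Q - X)).
      have : c^-1 * - Xdot (Q - Y) (Q - X) <= c^-1 * (Xnorm (Q - Y) * Xnorm (Q - X)).
        by rewrite ler_pM2l ?invr_gt0 //; lra.
      by rewrite mulrN; lra.
    by rewrite ler_pdivlMl // mulrA.
  have Bp : 0 < Xnorm (Q - X).
    rewrite lt_def B0 andbT; apply/eqP => B00; have [Y SY] := S0.
    have := key Y SY; rewrite B00 mulr0 leNgt => /negP; apply.
    by rewrite !mulr_gt0 // exprn_gt0.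
  have : c * kappa * D ^+ 2 / Xnorm (Q - X) <= D.
    by apply: le_dist => Y SY; rewrite ler_pdivrMr //; exact: key.
  by rewrite ler_pdivrMr // expr2 mulrA mulrC ler_pM2l.
pose s := Num.sqrt (1 + c ^+ 2 * kappa ^+ 2).
have s0 : 0 < s by rewrite sqrtr_gt0 ltr_pwDl // mulr_ge0 // sqr_ge0.
have s2 : s ^+ 2 = 1 + c ^+ 2 * kappa ^+ 2.
  by rewrite sqr_sqrtr // addr_ge0 // mulr_ge0 // sqr_ge0.
have -> : mu_rate kappa c = s^-1 by rewrite /mu_rate -/s div1r.
clearbody s; rewrite (ler_pdivlMl _ _ s0).
apply: le_dist => Y SY.
have hY : phi_le Y alpha by apply/SE.
have sD0 : 0 <= s * D by apply: mulr_ge0 => //; exact: ltW.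
rewrite -(@ler_pXn2r _ 2) ?nnegrE ?(enorm_ge0 Xdot) //.
rewrite exprMn s2.
have := prox_pythagoras hX phi_min c0 prox hY.
rewrite -!sqr_Xnorm => py.
have h1 : (c * kappa * D) ^+ 2 <= Xnorm (Q - X) ^+ 2.
  by rewrite ler_pXn2r ?nnegrE ?(enorm_ge0 Xdot) // !mulr_ge0 // ltW.
have h2 : D ^+ 2 <= Xnorm (Q - Y) ^+ 2.
  by rewrite ler_pXn2r ?nnegrE ?(enorm_ge0 Xdot) // dist_le.
apply: le_trans py; rewrite mulrDl mul1r.
by apply: (lerD h2); rewrite -!exprMn.
Qed.

Variables (X' : XX) (eta : R).
Hypothesis eta0 : 0 <= eta.
Hypothesis eta1 : eta < 1.
Hypothesis inexact : Xnorm (X' - Q) <= eta * Xnorm (X' - X).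

Lemma inexact_displacement_dist : Xnorm (X' - X) <= (1 - eta)^-1 * dist X S.
Proof.
rewrite ler_pdivlMl ?subr_gt0 //.
have : Xnorm (X' - X) <= Xnorm (X' - Q) + Xnorm (Q - X).
  exact: (enorm_triangle hX).
move: prox_displacement_dist inexact.
by move: (dist X S) (Xnorm (Q - X)) (Xnorm (X' - Q)) (Xnorm (X' - X)) => D a b x; lra.
Qed.

(** The factor obtained is mu + eta / (1 - eta), which is at most
(mu + 2 eta) / (1 - eta). *)
Lemma inexact_contraction mu : 0 <= mu -> dist Q S <= mu * dist X S ->
  dist X' S <= (mu + 2 * eta) * (1 - eta)^-1 * dist X S.
Proof.
move=> mu0 hQ; have h1 : 0 < 1 - eta by rewrite subr_gt0.
have d0 := dist_ge0 X.
move: (dist_triangle X' Q) inexact_displacement_dist inexact d0 hQ.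
move: (dist X S) (dist Q S) (dist X' S) (Xnorm (X' - X)) (Xnorm (X' - Q)).
move=> D DQ D' a b h4 h3 h2 d0 hQ.
rewrite mulrAC ler_pdivlMr //; rewrite ler_pdivlMl // in h3.
have : eta * ((1 - eta) * a) <= eta * D by rewrite ler_wpM2l.
have : (1 - eta) * D' <= (1 - eta) * (eta * a + mu * D).
  by rewrite ler_pM2l //; lra.
have : 0 <= mu * eta * D by rewrite !mulr_ge0.
have : 0 <= eta * D by rewrite mulr_ge0.
lra.
Qed.

End Rate.
End Distance.

(** * Limits of the rates *)

Section RateLimits.
Variables (R : realType) (c : nat -> R) (cinf : \bar R).
Hypothesis hc0 : forall k, 0 < c k.
Hypothesis hcmono : {homo c : i j / (i <= j)%N >-> i <= j}.
Hypothesis hcinf : (fun k => (c k)%:E) @ \oo --> cinf.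

Lemma penalty_limit :
  (exists r, [/\ cinf = r%:E, 0 < r & c @ \oo --> r]) \/
  (cinf = +oo%E /\ (fun k => (c k)^-1) @ \oo --> (0 : R)).
Proof.
case: cinf hcinf => [r| |] h.
- left; exists r; have cr : c @ \oo --> r by exact: (fine_cvg h).
  split => //; apply: (@lt_le_trans _ _ (c 0%N)) => //.
  by apply: (cvgr_to_ge cr); apply: filterE => k; exact: hcmono.
- right; split => //.
  apply/gtr0_cvgV0; first by apply: filterE => k; exact: hc0.
  by move/cvgeryP : h.
- exfalso; have : ((c 0%N)%:E <= -oo)%E; last by rewrite leeNy_eq.
  apply: (cvge_to_ge h); apply: filterE => k.
  by rewrite lee_fin; exact: hcmono.
Qed.

Lemma cvg_inv_penalty :
  (fun k => (c k)^-1) @ \oo --> at_cinf (fun x => 1 / x) cinf.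
Proof.
case: penalty_limit => [[r [-> r0 cr]]|[-> ic]]; last exact: ic.
by rewrite /at_cinf div1r; apply: cvgV => //; rewrite gt_eqF.
Qed.

Lemma cvg_mu_rate kappa : 0 < kappa ->
  (fun k => mu_rate kappa (c k)) @ \oo --> at_cinf (mu_rate kappa) cinf.
Proof.
move=> k0; case: penalty_limit => [[r [-> r0 cr]]|[-> ic]]; rewrite /at_cinf /mu_rate.
  apply: cvgM; first exact: cvg_cst.
  apply: cvgV.
    by rewrite gt_eqF // sqrtr_gt0 ltr_pwDl // mulr_ge0 // sqr_ge0.
  apply: (continuous_cvg _ (@sqrt_continuous _ _)).
  apply: cvgD; first exact: cvg_cst.
  by apply: cvgM; [exact: (cvgM cr cr)|exact: cvg_cst].
have up : (fun k => kappa^-1 * (c k)^-1) @ \oo --> (0 : R).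
  by rewrite -[X in _ --> X](mulr0 kappa^-1); apply: cvgM => //; exact: cvg_cst.
apply: (squeeze_cvgr _ (cvg_cst (0 : R)) up); apply: filterE => k.
have ck := hc0 k.
rewrite divr_ge0 ?sqrtr_ge0 //= div1r -invfM lef_pV2 ?posrE ?mulr_gt0 //; last first.
  by rewrite sqrtr_gt0 ltr_pwDl // mulr_ge0 // sqr_ge0.
have kc : 0 <= kappa * c k by rewrite mulr_ge0 // ltW.
rewrite -(ger0_norm kc) -sqrtr_sqr; apply: ler_wsqrtr.
by rewrite exprMn mulrC lerDr.
Qed.

End RateLimits.

(** * The augmented Lagrangian method *)

Section MultiplierStep.
Variables (R : realType) (n m d e : nat) (V : {vspace 'M[R]_(n, m)}).
Hypothesis hV : matrix_space V.
Variable P : problem d e V.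
Hypothesis hP : standing_assumptions P.
Hypothesis hOmegaP : OmegaP P !=set0.
Let hX := Xdot_euclidean hV.
Local Notation XX := (subvs_of V).
Local Notation Xdot := (@Xdot R n m V).
Variables (c : R) (X : XX).
Hypothesis c0 : 0 < c.

(** The quantities Q and v depend on c and X alone, so both stopping criteria
refer to the same exact proximal point. *)
Lemma multiplier_step : exists Q v,
  prox_step Xdot (primal_le P) c X Q v /\
  forall Z (sig : R), (subopt P c X Z <= sig%:E)%E ->
    Xnorm (X + c *: residual P Z - Q) ^+ 2 <= 2 * c * sig.
Proof.
have [mu [muE low app]] := inf_aug_lagrangian hV hP hOmegaP X c0.
have [Q [v [prox near]]] := aug_lagrangian_prox hV hP c0 low app.
exists Q, v; split=> // Z sig /(subopt_finP hV hP muE) [a [_ rel le _]].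
by rewrite (sqr_Xnorm hV); exact: near rel le.
Qed.

Lemma inf_aug_le_Psi_star :
  (ereal_inf [set aug_lagrangian P c Z X | Z in [set: dualvar d e V]]
   <= Psi_star P)%E.
Proof.
apply: le_ereal_inf_tmp => _ [Z /(residual_eq0 P Z) rZ <-].
apply: ge_ereal_inf; exists (aug_lagrangian P c Z X); first by exists Z.
rewrite /aug_lagrangian /lagrangian rZ (ip0r hX) (sqr_Xnorm hV) (ip0r hX).
by rewrite mulr0 !adde0.
Qed.

(** With X' = X + c r and r the residual of Z, Psi(Z) differs from L_c(Z, X) by
(|X|^2 - |X'|^2) / (2 c), and inf L_c(., X) <= Psi*. *)
Lemma dual_gap_le Z (sig : R) : (subopt P c X Z <= sig%:E)%E ->
  (Psi P Z - Psi_star P <= subopt P c X Z + (1 / (2 * c) *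
    (Xnorm X ^+ 2 - Xnorm (X + c *: residual P Z) ^+ 2))%:E)%E.
Proof.
have [mu [muE low app]] := inf_aug_lagrangian hV hP hOmegaP X c0.
move=> /(subopt_finP hV hP muE) [a [-> _ _ ->]].
have := inf_aug_le_Psi_star; rewrite muE.
case: (Psi_star P) => [ps| |] // hps; last by rewrite leNye.
rewrite -EFinB -EFinD lee_fin !(sqr_Xnorm hV) /quad.
move: (residual P Z) hps => r; rewrite lee_fin !(ipE hX) (ipC hX r X) => hps.
have -> : 1 / (2 * c) * (Xdot X X - (Xdot X X + c * Xdot X r
    + (c * Xdot X r + c * (c * Xdot r r)))) = - (Xdot X r + c / 2 * Xdot r r).
  by field; rewrite gt_eqF.
lra.
Qed.

End MultiplierStep.

Theorem theorem20 (R : realType) (n m d e : nat) (V : {vspace 'M[R]_(n, m)})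
    (hV : matrix_space V)
    (P : problem d e V) (hP : standing_assumptions P)
    (hOmegaP : OmegaP P !=set0)
    (c : nat -> R) (cinf : \bar R)
    (hc0 : forall k, 0 < c k)
    (hcmono : {homo c : i j / (i <= j)%N >-> i <= j})
    (hcinf : (fun k => (c k)%:E) @ \oo --> cinf)
    (eps : nat -> R)
    (heps0 : forall k, 0 <= eps k)
    (hepssum : cvgn (series eps))
    (Z : nat -> dualvar d e V) (X : nat -> subvs_of V)
    (hX : forall k, X k.+1 = X k + c k *: residual P (Z k.+1))
    (hA : forall k,
      (subopt P (c k) (X k) (Z k.+1) <= (eps k ^+ 2 / (2 * c k))%:E)%E) :
  (exists M : R, forall k, Xnorm (X k) <= M) /\
  exists Xinf : subvs_of V,
  [/\ OmegaP P Xinf,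
      (fun k => Xnorm (X k - Xinf)) @ \oo --> (0 : R) &
   [/\ (forall k,
          Xnorm (residual P (Z k.+1)) = (c k)^-1 * Xnorm (X k.+1 - X k)),
       (fun k => (c k)^-1 * Xnorm (X k.+1 - X k)) @ \oo --> (0 : R),
       (forall k,
          (Psi P (Z k.+1) - Psi_star P <=
           subopt P (c k) (X k) (Z k.+1)
           + (1 / (2 * c k) * (Xnorm (X k) ^+ 2 - Xnorm (X k.+1) ^+ 2))%:E)%E),
       (OmegaD P !=set0 -> dual_bounded (OmegaD P) ->
          dual_bounded (range Z) /\
          forall Zbar, accumulation_point Z Zbar -> OmegaD P Zbar) &
       (forall (kappa : R) (eta : nat -> R),
          0 < kappa ->
          quadratic_growth P Xinf kappa ->
          (forall k, 0 <= eta k) ->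
          cvgn (series eta) ->
          (forall k,
             (subopt P (c k) (X k) (Z k.+1) <=
              (eta k ^+ 2 / (2 * c k) * Xnorm (X k.+1 - X k) ^+ 2)%:E)%E) ->
          let theta k := (mu_rate kappa (c k) + 2 * eta k) * (1 - eta k)^-1 in
          let tau1 k := (c k)^-1 * (1 - eta k)^-1 in
          let tau2 k := tau1 k * (eta k ^+ 2 * Xnorm (X k.+1 - X k)
                                  + Xnorm (X k.+1) + Xnorm (X k)) / 2 in
          [/\ (exists kbar : nat, forall k, (kbar <= k)%N ->
                 [/\ dist (X k.+1) (OmegaP P)
                       <= theta k * dist (X k) (OmegaP P),
                     Xnorm (residual P (Z k.+1))
                       <= tau1 k * dist (X k) (OmegaP P) &
                     (Psi P (Z k.+1) - Psi_star P
                       <= (tau2 k * dist (X k) (OmegaP P))%:E)%E]),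
              theta @ \oo --> at_cinf (mu_rate kappa) cinf,
              tau1 @ \oo --> at_cinf (fun x => 1 / x) cinf &
              tau2 @ \oo --> at_cinf (fun x => Xnorm Xinf / x) cinf])]].
Proof.
have hX0 := Xdot_euclidean hV; have hZ0 := Zdot_euclidean d e hV.
pose nrm := enorm (@Xdot R n m V).
have [alpha [OP amin OPhi]] := OmegaP_primal_le hV hP hOmegaP.
have /choice [Qv hQv] : forall k, exists Qv : subvs_of V * R,
    prox_step (@Xdot R n m V) (primal_le P) (c k) (X k) Qv.1 Qv.2 /\
    forall (sig : R), (subopt P (c k) (X k) (Z k.+1) <= sig%:E)%E ->
      Xnorm (X k.+1 - Qv.1) ^+ 2 <= 2 * c k * sig.
  move=> k; have [Q [v [prox near]]] := multiplier_step hV hP hOmegaP (X k) (hc0 k).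
  by exists (Q, v); split=> // sig /near; rewrite -hX.
pose Q k := (Qv k).1; pose v k := (Qv k).2.
have prox k : prox_step (@Xdot R n m V) (primal_le P) (c k) (X k) (Q k) (v k).
  by have [] := hQv k.
have near k (r : R) : 0 <= r ->
    (subopt P (c k) (X k) (Z k.+1) <= (r ^+ 2 / (2 * c k))%:E)%E ->
    Xnorm (X k.+1 - Q k) <= r.
  move=> r0 h; have [_ /(_ _ h)] := hQv k.
  rewrite [2 * c k * _]mulrC divfK ?gt_eqF ?mulr_gt0 // => h2.
  by rewrite -(@ler_pXn2r _ 2) ?nnegrE // (enorm_ge0 (@Xdot R n m V)).
have [Xs /OP hXs] := hOmegaP.
have [bndX QX [Xinf /OP OXinf Xcv]] := inexact_proximal_point hX0 amin
  (fun X0 b b' => @primal_le_up _ _ _ _ _ _ _ X0 b b')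
  (primal_le_closed hV (P := P)) hXs (hc0 0%N) (fun k => hcmono _ _ (leq0n k)) prox
  heps0 hepssum (fun k => near k _ (heps0 k) (hA k)).
split; first exact: bndX.
exists Xinf; split => //.
have ic0 k : (c k)^-1 <= (c 0%N)^-1.
  by rewrite lef_pV2 ?posrE //; exact: hcmono.
have resE k : residual P (Z k.+1) = (c k)^-1 *: (X k.+1 - X k).
  by rewrite hX addrAC subrr add0r scalerA mulVf ?scale1r // gt_eqF.
have Xn0 (Y : subvs_of V) : 0 <= Xnorm Y by exact: (enorm_ge0 (@Xdot R n m V)).
have Xstep0 : (fun k => Xnorm (X k.+1 - X k)) @ \oo --> (0 : R).
  have up : (fun k => eps k + nrm (Q k - X k)) @ \oo --> (0 + 0 : R).
    by apply: cvgD => //; exact: cvg_series_cvg_0.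
  rewrite addr0 in up.
  apply: (squeeze_cvgr _ (cvg_cst (0 : R)) up); apply: filterE => k.
  rewrite Xn0 /=; apply: le_trans (enorm_triangle hX0 (Q k) _ _) _.
  by rewrite lerD2r; exact: near (heps0 k) (hA k).
have res0 : (fun k => (c k)^-1 * Xnorm (X k.+1 - X k)) @ \oo --> (0 : R).
  have up : (fun k => (c 0%N)^-1 * Xnorm (X k.+1 - X k)) @ \oo --> (c 0%N)^-1 * 0.
    by apply: cvgM => //; exact: cvg_cst.
  rewrite mulr0 in up.
  apply: (squeeze_cvgr _ (cvg_cst (0 : R)) up); apply: filterE => k.
  by rewrite mulr_ge0 ?invr_ge0 ?(ltW (hc0 k)) //= ler_wpM2r.
have resn k : Xnorm (residual P (Z k.+1)) = (c k)^-1 * Xnorm (X k.+1 - X k).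
  by rewrite resE [LHS](enormZ hX0) ger0_norm // invr_ge0 ltW.
have gap k : (Psi P (Z k.+1) - Psi_star P <=
    subopt P (c k) (X k) (Z k.+1)
    + (1 / (2 * c k) * (Xnorm (X k) ^+ 2 - Xnorm (X k.+1) ^+ 2))%:E)%E.
  by rewrite hX; exact: (dual_gap_le hV hP hOmegaP (hc0 k) (hA k)).
have nXcv : (fun k => Xnorm (X k)) @ \oo --> Xnorm Xinf.
  suff : (fun k => nrm (X k - 0)) @ \oo --> nrm (Xinf - 0).
    by under eq_fun do rewrite subr0; rewrite subr0.
  exact: (cvg_enormB hX0 _ Xcv 0).
have nXcvS : (fun k => Xnorm (X k.+1)) @ \oo --> Xnorm Xinf.
  by have := nXcv; rewrite -(cvg_shiftS (fun k => Xnorm (X k))); apply.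
split => //.
  move=> [Z0 OZ0] Obnd.
  have psE := Psi_star_val hV hP OZ0; set ps := fine _ in psE.
  (* The error in the bound on the dual objective, with c k replaced by its lower
     bound c 0. *)
  pose del k := (2 * c 0%N)^-1 *
    (eps k ^+ 2 + `|Xnorm (X k) ^+ 2 - Xnorm (X k.+1) ^+ 2|).
  have c20 : 0 < 2 * c 0%N by rewrite mulr_gt0.
  have PsiZ k : (Psi P (dpack (dunpack (Z k.+1))) <= (ps + del k)%:E)%E.
    have := le_trans (gap k) (leeD2r _ (hA k)).
    rewrite psE dunpackK leeBlDr // -!EFinD => /le_trans; apply.
    rewrite lee_fin [X in _ <= X]addrC lerD2r div1r [_ ^+ 2 / _]mulrC -mulrDr.
    have ck : (2 * c k)^-1 <= (2 * c 0%N)^-1.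
      by rewrite lef_pV2 ?posrE ?mulr_gt0 // ler_pM2l //; exact: hcmono.
    have ck0 : 0 <= (2 * c k)^-1 by rewrite invr_ge0 mulr_ge0 // ltW.
    apply: (@le_trans _ _ ((2 * c k)^-1 *
        (eps k ^+ 2 + `|Xnorm (X k) ^+ 2 - Xnorm (X k.+1) ^+ 2|))).
      by rewrite ler_wpM2l // lerD2l ler_norm.
    by rewrite ler_wpM2r // addr_ge0 // sqr_ge0.
  have del0 : del @ \oo --> (0 : R).
    have l1 : (fun k => (2 * c 0%N)^-1 * (eps k ^+ 2 +
        `|Xnorm (X k) ^+ 2 - Xnorm (X k.+1) ^+ 2|)) @ \oo --> (2 * c 0%N)^-1 *
        (0 * 0 + `|Xnorm Xinf ^+ 2 - Xnorm Xinf ^+ 2|).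
      apply: cvgM; first exact: cvg_cst.
      have e0 : eps @ \oo --> (0 : R) by apply: cvg_series_cvg_0.
      apply: cvgD; first exact: (cvgM e0 e0).
      apply: cvg_norm; apply: cvgB; first exact: (cvgM nXcv nXcv).
      exact: (cvgM nXcvS nXcvS).
    by rewrite subrr normr0 mulr0 addr0 mulr0 in l1.
  have resz0 : (fun k => nrm (residual P (dpack (dunpack (Z k.+1))))) @ \oo
      --> (0 : R).
    by under eq_fun do rewrite dunpackK [nrm _]resn.
  have [M hM] := dual_sequence_bounded hV hP OZ0 Obnd del0 resz0 PsiZ.
  split.
    exists (M + dual_norm (Z 0%N)) => _ [k _ <-].
    have M0 : 0 <= M by apply: le_trans (hM 0%N); exact: enorm_ge0.
    case: k => [|k]; first by rewrite lerDr.
    rewrite dual_normE; apply: le_trans (hM k) _.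
    by rewrite lerDl dual_normE enorm_ge0.
  move=> Zb acc.
  (* Z 0 is not produced by the method, hence the shift of the index. *)
  have /choice [g hg] : forall N, exists j, (N <= j)%N /\
      dual_dist (Z j.+1) Zb < N.+1%:R^-1.
    move=> N; have [|[//|j] Nj hj] := acc N.+1%:R^-1 _ N.+1; first by rewrite invr_gt0.
    by exists j.
  have gN N : (N <= g N)%N by have [] := hg N.
  rewrite -(dunpackK Zb); apply: (dual_limit hV hP OZ0 (F := \oo)
    (z := fun N => dunpack (Z (g N).+1)) (del := del \o g)).
  - apply: (squeeze_cvgr _ (cvg_cst (0 : R)) (@cvg_harmonic R)).
    apply: filterE => N; rewrite enorm_ge0 /= -dual_distE ltW //.
    by have [] := hg N.
  - exact: (cvg_subsequence gN del0).
  - exact: (cvg_subsequence gN resz0).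
  - by move=> N; exact: PsiZ.
move=> kappa eta k0 [delta delta0 growth] eta0 etasum hB theta tau1 tau2.
have etac : eta @ \oo --> (0 : R) by apply: cvg_series_cvg_0.
have QXinf : (fun k => nrm (Q k - Xinf)) @ \oo --> (0 : R).
  have up : (fun k => nrm (Q k - X k) + nrm (X k - Xinf)) @ \oo --> (0 + 0 : R).
    exact: (cvgD QX Xcv).
  rewrite addr0 in up.
  apply: (squeeze_cvgr _ (cvg_cst (0 : R)) up); apply: filterE => k.
  by rewrite enorm_ge0 /= (enorm_triangle hX0).
have ieta : (fun k => (1 - eta k)^-1) @ \oo --> (1 : R).
  rewrite -[X in _ --> X]invr1; apply: cvgV; first exact: oner_neq0.
  by rewrite -[X in _ --> X]subr0; apply: cvgB => //; exact: cvg_cst.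
have icv := cvg_inv_penalty hc0 hcmono hcinf.
have tau1cv : tau1 @ \oo --> at_cinf (fun x => 1 / x) cinf.
  by rewrite -[X in _ --> X]mulr1; apply: cvgM.
split => //.
- have ev1 : \forall k \near \oo, eta k < 1 by apply: (cvgr_lt (0 : R)).
  have ev2 : \forall k \near \oo, nrm (Q k - Xinf) <= delta.
    by apply: (cvgr_le (0 : R)).
  have [N _ hN] := filterI ev1 ev2; exists N => k /hN [eta1 Qd].
  have inex : Xnorm (X k.+1 - Q k) <= eta k * Xnorm (X k.+1 - X k).
    apply: near; first by rewrite mulr_ge0.
    by rewrite exprMn mulrAC; exact: hB.
  have grow : alpha + kappa * dist (Q k) (OmegaP P) ^+ 2 <= v k.
    have [/(primal_leP hV hP) [fQ PQ] _] := prox k.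
    have := le_trans (growth _ fQ Qd) PQ.
    by rewrite (OPhi _ OXinf) -EFinD lee_fin.
  have disp := inexact_displacement_dist hV hOmegaP amin OP (hc0 k) (prox k) eta1 inex.
  have mu0 : 0 <= mu_rate kappa (c k) by rewrite divr_ge0 // sqrtr_ge0.
  split.
  + apply: (inexact_contraction hV hOmegaP amin OP (hc0 k) (prox k) (eta0 k) eta1 inex mu0).
    exact: (prox_contraction hV hOmegaP amin OP (hc0 k) (prox k) k0 grow).
  + by rewrite resn /tau1 -mulrA ler_pM2l ?invr_gt0.
  + have := le_trans (gap k) (leeD2r _ (hB k)); move/le_trans; apply.
    rewrite -EFinD lee_fin.
    have : Xnorm (X k) <= Xnorm (X k.+1 - X k) + Xnorm (X k.+1).
      have := enorm_triangle hX0 (X k.+1) (X k) 0.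
      by rewrite !subr0 (enormB hX0 (X k)).
    move: disp (Xn0 (X k.+1 - X k)) (Xn0 (X k.+1)) (Xn0 (X k)).
    rewrite /tau2 /tau1.
    move: (dist _ _) (Xnorm (X k.+1 - X k)) (Xnorm (X k.+1)) (Xnorm (X k)).
    move=> D w b a disp w0 b0 a0 tri.
    have ci : 0 < (c k)^-1 by rewrite invr_gt0.
    have s0 : 0 <= eta k ^+ 2 * w + b + a by rewrite !addr_ge0 // mulr_ge0 // sqr_ge0.
    (* a^2 - b^2 <= w (a + b), and then w is bounded through D. *)
    have h1 : eta k ^+ 2 * w ^+ 2 + (a ^+ 2 - b ^+ 2) <=
        (1 - eta k)^-1 * D * (eta k ^+ 2 * w + b + a).
      apply: (@le_trans _ _ (w * (eta k ^+ 2 * w + b + a))); last by rewrite ler_wpM2r.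
      nra.
    have -> : eta k ^+ 2 / (2 * c k) * w ^+ 2 + 1 / (2 * c k) * (a ^+ 2 - b ^+ 2) =
        (c k)^-1 / 2 * (eta k ^+ 2 * w ^+ 2 + (a ^+ 2 - b ^+ 2)).
      by field; rewrite gt_eqF.
    have -> : (c k)^-1 * (1 - eta k)^-1 * (eta k ^+ 2 * w + b + a) / 2 * D =
        (c k)^-1 / 2 * ((1 - eta k)^-1 * D * (eta k ^+ 2 * w + b + a)) by ring.
    by rewrite ler_wpM2l // mulr_ge0 // ltW.
- rewrite -[X in _ --> X]mulr1; apply: cvgM => //.
  rewrite -[X in _ --> X]addr0 -(mulr0 2); apply: cvgD.
    exact: (cvg_mu_rate hc0 hcmono hcinf k0).
  by apply: cvgM => //; exact: cvg_cst.
- have -> : at_cinf (fun x => Xnorm Xinf / x) cinf =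
      at_cinf (fun x => 1 / x) cinf *
      (0 * 0 * 0 + Xnorm Xinf + Xnorm Xinf) / 2.
    case: (cinf) => [r| |]; rewrite /at_cinf !mul0r // add0r div1r.
    by rewrite -[RHS]mulrA [LHS]mulrC; congr (_ * _); lra.
  apply: cvgM; last exact: cvg_cst.
  apply: cvgM => //; apply: cvgD => //; apply: cvgD => //.
  by apply: cvgM => //; exact: (cvgM etac etac).
Qed.
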